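(* Let $d\ge 1$. There is a constant $C>0$ depending only on $d$ such that the following holds. Let $A,B\subset\mathbb{R}^d$ be open sets and let $\varphi:B\to A$ be a $C^1$ bijection. Let $r\ge 1$, $p\ge 1$, $\alpha>0$, $\tau_0>0$ and $0<\omega<1$. Suppose $f\in L^r(\mathbb{R}^d)$ is supported on $A$ and satisfies $\|f_\varphi\|_{L^r}\le\|f\|_{L^r}<\infty$. Let $\varepsilon=\varepsilon(\varphi)=\max_{x\in B}|x-\varphi(x)|$ and suppose $\varepsilon<\sqrt{\tau_0}$. Then $$\mathrm{D}_{\alpha,p,r}(f,f_\varphi)\ \le\ C\cdot\|f\|_{L^r}\cdot\frac{\tau_0^{\alpha/2}}{1-\omega^{1/2}}\cdot\Delta_{\alpha,p}\big(\varepsilon/\sqrt{\tau_0}\big).$$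
   Context: Functions are real-valued; $|\cdot|$ is the Euclidean norm. Deformation: for a $C^1$ bijection $\varphi:B\to A$ between open subsets of $\mathbb{R}^d$ and $f$ supported on $A$, $f_\varphi(x)=f(\varphi(x))\,|\nabla\varphi(x)|$ for $x\in B$, where $|\nabla\varphi(x)|$ is the absolute value of the determinant of the Jacobian matrix of $\varphi$ at $x$; $f_\varphi$ is extended by $0$ outside $B$. Scale-space metric: for $\tau>0$ let $G_\tau(x)=(\pi\tau)^{-d/2}e^{-|x|^2/\tau}$ on $\mathbb{R}^d$. With fixed $\tau_0>0$, $0<\omega<1$, set $\tau_k=\tau_0\omega^k$, $k\ge 0$. For $u,v\in L^r(\mathbb{R}^d)$, $$\mathrm{D}_{\alpha,p,r}(u,v)=\Big(\sum_{k\ge 0}\tau_k^{p\alpha/2}\,\|G_{\tau_k}*(u-v)\|_{L^r}^p\Big)^{1/p}.$$ The function $\Delta_{\alpha,p}$: for $0<\epsilon<1$, $$\Delta_{\alpha,p}(\epsilon)=\begin{cases}\epsilon^\alpha/(\alpha-\alpha^2)^{1/p}, & 0<\alpha<1,\\ \epsilon\,(\log(1/\epsilon)+1)^{1/p}, & \alpha=1,\\ \epsilon/\min\{(\alpha-1)^{1/p},1\}, & \alpha>1,\end{cases}$$ and $\Delta_{\alpha,p}(0)=0$. *)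

(* Defs.v *)
From HB Require Import structures.
From mathcomp Require Import all_boot all_order all_algebra.
From mathcomp Require Import all_classical all_reals all_analysis.
From mathcomp Require Import measurable_realfun.

Set Implicit Arguments.
Unset Strict Implicit.
Unset Printing Implicit Defensive.
Import Order.TTheory GRing.Theory Num.Theory.
Import numFieldNormedType.Exports.
Local Open Scope classical_set_scope.
Local Open Scope ring_scope.

(* As for tuples in the library, 'rV[R]_n carries the sigma-algebra generated
   by the coordinates; it is the Borel sigma-algebra, see [open_measurable_rV]
   and [measurable_rV_borel]. *)
Definition measure_rV_display : measure_display -> measure_display.
Proof. exact. Qed.

Section measurable_rV.
Context {R : realType} (n : nat).

Let coors : 'I_n -> 'rV[R]_n -> measurableTypeR R := fun i x => x ord0 i.

Let rV_set0 : g_sigma_preimage coors set0.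
Proof. exact: sigma_algebra0. Qed.

Let rV_setC A : g_sigma_preimage coors A -> g_sigma_preimage coors (~` A).
Proof. exact: sigma_algebraC. Qed.

Let rV_bigcup (F : (set 'rV[R]_n)^nat) :
  (forall i, g_sigma_preimage coors (F i)) ->
  g_sigma_preimage coors (\bigcup_i (F i)).
Proof. exact: sigma_algebra_bigcup. Qed.

HB.instance Definition _ := @isMeasurable.Build
  (measure_rV_display (R.-ocitv.-measurable).-sigma)
  'rV[R]_n (g_sigma_preimage coors) rV_set0 rV_setC rV_bigcup.

Lemma measurable_coor (i : 'I_n) :
  measurable_fun [set: 'rV[R]_n] (fun x => x ord0 i : measurableTypeR R).
Proof.
move=> _ Y mY; rewrite setTI; apply: sub_sigma_algebra => /=.
rewrite -bigcup_seq/=; exists i => /=; first by rewrite mem_index_enum.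
by exists Y => //; rewrite setTI.
Qed.

Lemma measurable_fun_rVP d (T : measurableType d) (f : T -> 'rV[R]_n) :
  measurable_fun [set: T] f <->
  forall i, measurable_fun [set: T] (fun x => f x ord0 i : measurableTypeR R).
Proof.
split=> [mf i|mf].
  exact: (measurableT_comp (measurable_coor i) mf).
move=> _ A mA; rewrite setTI.
move: A mA; apply: smallest_sub => /=.
  split=> [|B mB|F mF] /=.
  - by rewrite preimage_set0; exact: measurable0.
  - by rewrite setTD preimage_setC; exact: measurableC.
  - by rewrite preimage_bigcup; exact: bigcup_measurable.
move=> B; rewrite -bigcup_seq => -[i /= _ [Y mY <-]] /=.
by rewrite setTI -[X in measurable X]setTI; exact: (mf i).
Qed.

Lemma open_measurable_rV (U : set 'rV[R]_n) : open U -> measurable U.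
Proof.
move=> oU.
pose box (q : 'rV[rat]_n * nat) : set 'rV[R]_n :=
  [set x | forall i, `|ratr (q.1 ord0 i) - x ord0 i| < q.2.+1%:R^-1].
have mbox q : measurable (box q).
  have -> : box q = \bigcap_(i in [set: 'I_n])
      ((fun x : 'rV[R]_n => x ord0 i : measurableTypeR R) @^-1`
       ball (ratr (q.1 ord0 i) : R) q.2.+1%:R^-1).
    by apply/seteqP; split => [x xq i _|x xq i]; [exact: xq|exact: (xq i)].
  apply: fin_bigcap_measurable => //.
  move=> i _; rewrite -[X in measurable X]setTI.
  by apply: measurable_coor => //; exact: measurable_ball.
have -> : U = \bigcup_(q in [set q | box q `<=` U]) box q.
  apply/seteqP; split=> [x Ux|x [q /= qU /qU//]].
  have /nbhs_ballP[e /= e0 eU] : nbhs x U by exact: open_nbhs_nbhs.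
  have [k ke] : exists k : nat, k.+1%:R^-1 < e / 2 :> R.
    have e20 : 0 < e / 2 by rewrite divr_gt0.
    exists (Num.truncn (e / 2)^-1).
    by rewrite invf_plt ?posrE// truncnS_gt.
  have qx i : exists q : rat, `|ratr q - x ord0 i| < k.+1%:R^-1.
    have k0 : 0 < k.+1%:R^-1 :> R by [].
    have /rat_in_itvoo[q] : x ord0 i - k.+1%:R^-1 < x ord0 i + k.+1%:R^-1.
      by rewrite ltrBlDr -addrA ltrDl addr_gt0.
    by rewrite in_itv/= => /andP[q1 q2]; exists q; rewrite ltr_distl q1 q2.
  exists (\row_i sval (cid (qx i)), k) => /=; last first.
    by move=> i /=; rewrite mxE; case: cid.
  move=> y yq; apply: eU; split=> // i j; rewrite ord1.
  rewrite /ball/=.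
  rewrite (splitr e).
  have := yq j; rewrite /= mxE; case: cid => /= q qk qy.
  apply: (@le_lt_trans _ _ (`|x ord0 j - ratr q| + `|ratr q - y ord0 j|)).
    by rewrite (le_trans _ (ler_normD _ _))// addrA subrK.
  by rewrite ltrD// ?(lt_trans _ ke)// distrC.
rewrite bigcup_mkcond; apply: countable_bigcupT_measurable => // q.
by case: ifP => // _; exact: mbox.
Qed.

Lemma measurable_rV_borel : @measurable _ 'rV[R]_n = <<s @open 'rV[R]_n >>.
Proof.
apply/seteqP; split; last first.
  apply: smallest_sub; first exact: sigma_algebra_measurable.
  by move=> U; exact: open_measurable_rV.
apply: smallest_sub; first exact: smallest_sigma_algebra.
move=> B; rewrite -bigcup_seq => -[i /= _ [Y mY <-]] /=.
rewrite setTI; have := mY; rewrite RGenOpens.measurableE.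
move: Y {mY}; apply: smallest_sub => [|Y [x [y ->]]] /=.
  split=> [|C mC|F mF] /=.
  - by rewrite preimage_set0; exact: sigma_algebra0.
  - by rewrite setTD preimage_setC -setTD; exact: sigma_algebraCD.
  - by rewrite preimage_bigcup; exact: sigma_algebra_bigcup.
apply: sub_sigma_algebra; apply: open_comp => [z _|]; first exact: coord_continuous.
exact: interval_open.
Qed.

End measurable_rV.

Section lebesgue_rV.
Context {R : realType}.

Definition cons_rV n (x : measurableTypeR R * 'rV[R]_n) : 'rV[R]_n.+1 :=
  \row_i if unlift ord0 i is Some j then x.2 ord0 j else x.1.

Lemma cons_rV0 n x : @cons_rV n x ord0 ord0 = x.1.
Proof. by rewrite mxE unlift_none. Qed.

Lemma cons_rVS n x i : @cons_rV n x ord0 (lift ord0 i) = x.2 ord0 i.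
Proof. by rewrite mxE liftK. Qed.

Lemma measurable_cons_rV n :
  measurable_fun [set: measurableTypeR R * 'rV[R]_n] (@cons_rV n).
Proof.
apply/measurable_fun_rVP => i.
case: (unliftP ord0 i) => [j ->|->].
  under eq_fun do rewrite cons_rVS.
  exact: (measurableT_comp (measurable_coor j) measurable_snd).
by under eq_fun do rewrite cons_rV0; exact: measurable_fst.
Qed.

Section step.
Variables (n : nat) (mu : {sigma_finite_measure set 'rV[R]_n -> \bar R}).

Definition lebesgue_rV_step : set 'rV[R]_n.+1 -> \bar R :=
  pushforward (lebesgue_measure \x mu)%E (@cons_rV n).

Let pf : {measure set 'rV[R]_n.+1 -> \bar R} :=
  measure_function_pushforward__canonical__measure_function_Measure
    (lebesgue_measure \x mu)%E (@measurable_cons_rV n).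

HB.instance Definition _ := isMeasure.Build _ _ _ lebesgue_rV_step
  (measure0 pf) (measure_ge0 pf) (@measure_semi_sigma_additive _ _ _ pf).

Let step_sigma_finite : sigma_finite setT lebesgue_rV_step.
Proof.
have /sigma_finiteP[F [FT ndF Foo]] :=
  sigma_finiteT (@lebesgue_measure R : {sigma_finite_measure set _ -> \bar R}).
have /sigma_finiteP[G [GT ndG Goo]] := sigma_finiteT mu.
pose tail (x : 'rV[R]_n.+1) : measurableTypeR R * 'rV[R]_n :=
  (x ord0 ord0, \row_i x ord0 (lift ord0 i)).
have mtail : measurable_fun setT tail.
  apply/measurable_fun_pair; first exact: measurable_coor.
  apply/measurable_fun_rVP => i.
  by under eq_fun do rewrite mxE; exact: measurable_coor.
have tailK x : tail (cons_rV x) = x.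
  case: x => a y; rewrite /tail cons_rV0; congr pair.
  by apply/rowP => i; rewrite mxE cons_rVS.
exists (fun k => tail @^-1` (F k `*` G k)).
  apply/seteqP; split => // x _.
  have [i _ Fi] : (\bigcup_i F i) (tail x).1 by rewrite -FT.
  have [j _ Gj] : (\bigcup_i G i) (tail x).2 by rewrite -GT.
  exists (maxn i j) => //; split.
    by move: Fi; exact/subsetPset/ndF/leq_maxl.
  by move: Gj; exact/subsetPset/ndG/leq_maxr.
move=> k; have [mF Fk] := Foo k; have [mG Gk] := Goo k; split.
  by rewrite -[X in measurable X]setTI; apply: mtail => //; exact: measurableX.
rewrite /lebesgue_rV_step /pushforward -comp_preimage.
rewrite (_ : tail \o _ = id) ?preimage_id.
  by rewrite product_measure1E// lte_mul_pinfty// ge0_fin_numE.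
by apply/funext => x /=; exact: tailK.
Qed.

HB.instance Definition _ := Measure_isSigmaFinite.Build _ _ _ lebesgue_rV_step
  step_sigma_finite.

End step.

(* The n-fold product of [lebesgue_measure]; see [lebesgue_rV_box]. *)
Fixpoint lebesgue_rV n : {sigma_finite_measure set 'rV[R]_n -> \bar R} :=
  match n with
  | 0 => \d_(0 : 'rV[R]_0)
  | m.+1 => lebesgue_rV_step (lebesgue_rV m)
  end.

Lemma lebesgue_rV_box n (a b : 'rV[R]_n) :
  (forall i, a ord0 i <= b ord0 i) ->
  lebesgue_rV n [set x | forall i, a ord0 i < x ord0 i <= b ord0 i] =
  (\prod_i (b ord0 i - a ord0 i))%:E.
Proof.
elim: n a b => [|n IH] a b ab.
  by rewrite big_ord0/= diracE mem_set//; case.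
pose tl (x : 'rV[R]_n.+1) : 'rV[R]_n := \row_i x ord0 (lift ord0 i).
have mbox : measurable [set x : 'rV[R]_n |
    forall i, tl a ord0 i < x ord0 i <= tl b ord0 i].
  rewrite [X in measurable X](_ : _ = \bigcap_(i in [set: 'I_n])
      ((fun x : 'rV[R]_n => x ord0 i : measurableTypeR R) @^-1`
       `]tl a ord0 i, tl b ord0 i]%classic)); last first.
    apply/seteqP; split => [x xab i _|x xab i].
      by rewrite /preimage/mkset/= in_itv/=; exact: xab.
    by have := xab i I; rewrite /preimage/mkset/= in_itv.
  apply: fin_bigcap_measurable => [|i _]; first exact: finite_finset.
  rewrite -[X in measurable X]setTI.
  by apply: measurable_coor => //; exact: measurable_itv.
rewrite /= /lebesgue_rV_step /pushforward.
rewrite (_ : _ @^-1` _ = `]a ord0 ord0, b ord0 ord0]%classic `*`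
    [set x : 'rV[R]_n | forall i, tl a ord0 i < x ord0 i <= tl b ord0 i]).
  rewrite product_measure1E//= IH; last by move=> i; rewrite !mxE.
  rewrite lebesgue_measure_itv/= lte_fin big_ord_recl.
  under eq_bigr do rewrite !mxE.
  have [//|ba] := ltP (a ord0 ord0) (b ord0 ord0).
  have -> : b ord0 ord0 = a ord0 ord0 by apply/eqP; rewrite eq_le ba ab.
  by rewrite subrr mul0r mul0e.
apply/seteqP; split => [[t y] /= H|[t y] /= [H0 H] i].
  split; first by have := H ord0; rewrite cons_rV0/= in_itv.
  by move=> i; have := H (lift ord0 i); rewrite cons_rVS/= !mxE.
case: (unliftP ord0 i) => [j ->|->].
  by have := H j; rewrite cons_rVS/= !mxE.
by move: H0; rewrite cons_rV0 in_itv.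
Qed.

End lebesgue_rV.

Section scale_space.
Context {R : realType} {d : nat}.
Implicit Types (A B : set 'rV[R]_d) (phi : 'rV[R]_d -> 'rV[R]_d).
Implicit Types (f g u v : 'rV[R]_d -> R) (x y : 'rV[R]_d).

(* The norm of the library on 'rV is the sup norm. *)
Definition enorm x : R := Num.sqrt (\sum_i x ord0 i ^+ 2).

Definition C1_on B phi : Prop :=
  (forall x, B x -> differentiable phi x) /\
  {within B, continuous (fun x => 'J phi x)}.

(* 'J acts on row vectors, so it is the transpose of the usual Jacobian matrix;
   the determinant is the same. *)
Definition deformation B phi f : 'rV[R]_d -> R :=
  (fun x => f (phi x) * `|\det ('J phi x)|) \_ B.

(* Extended-real supremum over the possibly unbounded B; it is -oo when B is
   empty, and then [fine] makes it 0. *)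
Definition displacement B phi : \bar R :=
  ereal_sup [set (enorm (x - phi x))%:E | x in B].

Definition gaussian (tau : R) x : R :=
  (pi * tau) `^ (- (d%:R / 2)) * expR (- (enorm x ^+ 2 / tau)).

Definition convolution g u x : R :=
  \int[lebesgue_rV d]_y (g (x - y) * u y).

(* With values in \bar R, since finiteness of the series is part of the bounds
   to be proved. *)
Definition scale_metric (alpha p r tau0 omega : R) u v : \bar R :=
  let tau k : R := tau0 * omega ^+ k in
  ((\sum_(0 <= k <oo)
     (tau k `^ (p * alpha / 2))%:E *
     'N[lebesgue_rV d]_(r%:E)[EFin \o
        convolution (gaussian (tau k)) (fun y => u y - v y)%R] `^ p)
   `^ p^-1)%E.

End scale_space.

(* The case distinction is meant for 0 < alpha and 0 <= eps < 1. *)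
Definition Delta {R : realType} (alpha p eps : R) : R :=
  if eps == 0 then 0
  else if alpha < 1 then eps `^ alpha / (alpha - alpha ^+ 2) `^ p^-1
  else if alpha == 1 then eps * (ln eps^-1 + 1) `^ p^-1
  else eps / Num.min ((alpha - 1) `^ p^-1) 1.

(* Main.v *)
(* By the change of variables y = phi z, the smoothed difference is
   G_tau * (f - f_phi) (x) = int_B (G_tau (x - phi z) - G_tau (x - z)) f_phi z dz.
   As |z - phi z| <= eps, the difference of Gaussians is at most
   C (eps / sqrt tau) H_tau (x - z) for a wider Gaussian H_tau of mass 2^d, and
   Young's inequality bounds the L^r norm by C min(1, eps / sqrt tau) |f|_r. It
   remains to sum the resulting truncated geometric series in k.

   Since phi may have critical points and f is merely in L^r, the change of
   variables for C^1 bijections is needed in full. For the sup norm, an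
   L-Lipschitz map multiplies volumes by at most L^d (cover by small cubes).
   Near a regular point x, composing phi with the inverse of its derivative at x
   gives a map that is Lipschitz together with its inverse, with constants close
   to 1; near a critical point, stretching a direction missed by the derivative
   by a huge factor keeps the Lipschitz constant bounded, so that the image has
   small relative volume. Only the volume formula for invertible linear
   maps is used, and it follows from Fubini's theorem by elimination. *)
Require Import Defs.
From mathcomp Require Import all_boot all_order all_algebra.
From mathcomp Require Import all_classical all_reals all_analysis.
From mathcomp Require Import perm measurable_realfun.
From mathcomp Require Import ring lra.
Import Order.TTheory GRing.Theory Num.Theory.
Import numFieldNormedType.Exports.
Local Open Scope classical_set_scope.
Local Open Scope ring_scope.

Set Implicit Arguments.
Unset Strict Implicit.
Unset Printing Implicit Defensive.

(** * Boxes and grids *)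

(** The displacement is small only relative to scales with sqrt tau_k >= eps. Below them only the
    bound |f_phi|_r <= |f|_r is left, and this produces the minimum with 1. Put q = sqrt omega and s
    = eps / sqrt tau_0. Then eps / sqrt tau_k = s / q^k and tau_k^(alpha/2) = tau_0^(alpha/2)
    (q^k)^alpha, hence the square root of omega in the bound. The three cases of [Delta] reflect
    whether (q^k)^alpha min(1, s / q^k) grows (alpha < 1), is constant (alpha = 1) or decays (alpha
    > 1) in k as long as q^k >= s.

    The obstacle in the change of variables is that volumes are compared only near each point and
    only up to a factor. Both the volume of the image and the integral of the Jacobian are countably
    additive on subsets of B, so the comparisons on countably many grid cells add up; only then does
    the factor tend to 1. For this the images of Borel sets must be measurable, which rests on
    injectivity. *)

Section boxes.
Context {R : realType} (n : nat).
Implicit Types (a b x y v : 'rV[R]_n) (E U : set 'rV[R]_n).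

Definition rV_box a b : set 'rV[R]_n :=
  [set x | forall i, a ord0 i < x ord0 i <= b ord0 i].

Lemma normr_coord_le x i : `|x ord0 i| <= `|x|.
Proof.
rewrite [leRHS]mx_normrE.
exact: (le_bigmax_cond _ (fun i : 'I_1 * 'I_n => `|x i.1 i.2|) (j := (ord0, i))).
Qed.

Lemma measurable_rV_box a b : measurable (rV_box a b).
Proof.
rewrite (_ : rV_box a b = \bigcap_(i in [set: 'I_n])
    ((fun x : 'rV[R]_n => x ord0 i : measurableTypeR R) @^-1`
     `]a ord0 i, b ord0 i]%classic)); last first.
  apply/seteqP; split => [x xab i _|x xab i].
    by rewrite /preimage/mkset/= in_itv/=; exact: xab.
  by have := xab i I; rewrite /preimage/mkset/= in_itv.
apply: fin_bigcap_measurable => [|i _]; first exact: finite_finset.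
rewrite -[X in measurable X]setTI.
by apply: measurable_coor => //; exact: measurable_itv.
Qed.

(** Half-open cells of side 1/(m+1): those of one mesh partition the space, and the index type is
    countable, so that cells of all meshes can be enumerated by [pickle]. *)
Definition grid (q : nat * 'rV[int]_n) : set 'rV[R]_n :=
  rV_box (\row_i ((q.2 ord0 i)%:~R / q.1.+1%:R))
         (\row_i (((q.2 ord0 i)%:~R + 1) / q.1.+1%:R)).

Lemma measurable_grid q : measurable (grid q).
Proof. exact: measurable_rV_box. Qed.

Lemma gridE m k x : grid (m, k) x <->
  forall i, (k ord0 i)%:~R < x ord0 i * m.+1%:R <= (k ord0 i)%:~R + 1.
Proof.
have m0 : 0 < m.+1%:R :> R by [].
split => H i; have := H i.
  by rewrite !mxE ltr_pdivrMr// ler_pdivlMr.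
by rewrite !mxE ltr_pdivrMr// ler_pdivlMr.
Qed.

Lemma grid_cover m x : exists k, grid (m, k) x.
Proof.
(* The cells are open on the left, hence the ceiling minus 1 instead of the floor. *)
exists (\row_i (Num.ceil (x ord0 i * m.+1%:R) - 1)).
by apply/gridE => i; rewrite mxE gt_pred_ceil/= intrB subrK ceil_ge.
Qed.

Lemma grid_inj m k k' x : grid (m, k) x -> grid (m, k') x -> k = k'.
Proof.
move=> /gridE xk /gridE xk'; apply/rowP => i.
have /andP[a1 b1] := xk i; have /andP[a2 b2] := xk' i.
apply/eqP; rewrite eq_le -!ltzD1 -!(ltr_int R) !intrD !mulr1z.
by rewrite (lt_le_trans a1)// (lt_le_trans a2).
Qed.

Lemma grid_close m k x y : grid (m, k) x -> grid (m, k) y ->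
  `|x - y| <= m.+1%:R^-1.
Proof.
move=> /gridE xk /gridE yk; have m0 : 0 < m.+1%:R :> R by [].
rewrite [leLHS]mx_normrE; apply/bigmax_leP; split => [|[i j] _] /=.
  by rewrite invr_ge0 ltW.
rewrite ord1 !mxE -[leRHS]mul1r ler_pdivlMr// -[X in _ * X](ger0_norm (ltW m0)).
rewrite -normrM mulrBl ler_norml.
by have /andP[? ?] := xk j; have /andP[? ?] := yk j; apply/andP; split; lra.
Qed.

Lemma exists_grid_mesh (e : R) : 0 < e -> exists N, forall m, (N <= m)%N ->
  m.+1%:R^-1 < e.
Proof.
move=> e0; exists (Num.truncn e^-1) => m Nm.
rewrite invf_plt ?posrE// (lt_le_trans (truncnS_gt _))//.
by rewrite ler_nat ltnS.
Qed.

Lemma open_grid U : open U -> U = \bigcup_(q in [set q | grid q `<=` U]) grid q.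
Proof.
move=> oU; apply/seteqP; split=> [x Ux|x [q /= qU /qU//]].
have /nbhs_ballP[e /= e0 eU] : nbhs x U by exact: open_nbhs_nbhs.
have [m me] := exists_grid_mesh e0.
have [k xk] := grid_cover m x.
exists (m, k) => //= y yk; apply: eU.
by rewrite -ball_normE/= (le_lt_trans (grid_close xk yk))// me.
Qed.

Lemma rV_box_setI a b a' b' :
  (forall i, a ord0 i <= b ord0 i) -> (forall i, a' ord0 i <= b' ord0 i) ->
  exists c d : 'rV[R]_n, (forall i, c ord0 i <= d ord0 i) /\
    rV_box a b `&` rV_box a' b' = rV_box c d.
Proof.
move=> ab ab'.
pose c : 'rV[R]_n := \row_i Num.max (a ord0 i) (a' ord0 i).
pose d : 'rV[R]_n := \row_i Num.min (b ord0 i) (b' ord0 i).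
have E : rV_box a b `&` rV_box a' b' = rV_box c d.
  apply/seteqP; split => [x [H H'] i|x H].
    rewrite !mxE gt_max le_min.
    by have /andP[-> ->] := H i; have /andP[-> ->] := H' i.
  by split => i; have := H i; rewrite !mxE gt_max le_min =>
    /andP[/andP[h1 h2] /andP[h3 h4]]; apply/andP.
have [cd|] := pselect (forall i, c ord0 i <= d ord0 i); first by exists c, d.
move=> /existsNP[i /negP]; rewrite -ltNge => dc.
(* The intersection is empty because of coordinate [i]; so is the box with both corners [c], which
   has ordered corners as required. *)
exists c, c; split => //; rewrite E; apply/seteqP; split => x H; exfalso.
  by have /andP[/lt_le_trans H1 /H1] := H i; rewrite ltNge (ltW dc).
by have /andP[/lt_le_trans H1 /H1] := H i; rewrite ltxx.
Qed.

(** Boxes are stable under intersection, generate the Borel sets through the grid cells, and include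
    cubes of finite volume exhausting the space; so a measure is determined by its values on
    them. *)
Lemma lebesgue_rV_unique (mu : {measure set 'rV[R]_n -> \bar R}) :
  (forall a b, (forall i, a ord0 i <= b ord0 i) ->
     mu (rV_box a b) = (\prod_i (b ord0 i - a ord0 i))%:E) ->
  forall E, measurable E -> lebesgue_rV n E = mu E.
Proof.
move=> mubox E mE.
pose G : set_system 'rV[R]_n :=
  [set X | exists a b : 'rV[R]_n, (forall i, a ord0 i <= b ord0 i) /\ X = rV_box a b].
apply: (measure_unique G (fun k => rV_box (const_mx (- k%:R)) (const_mx k%:R))).
- apply/seteqP; split; last first.
    apply: smallest_sub; first exact: sigma_algebra_measurable.
    by move=> _ [a [b [_ ->]]]; exact: measurable_rV_box.
  rewrite measurable_rV_borel; apply: smallest_sub.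
    exact: smallest_sigma_algebra.
  move=> U oU; rewrite (open_grid oU).
  have grG q : <<s G >> (grid q).
    apply: sub_sigma_algebra; exists (\row_i ((q.2 ord0 i)%:~R / q.1.+1%:R)).
    eexists; split; last by reflexivity.
    by move=> i; rewrite !mxE ler_pdivrMr// divfK// lerDl.
  rewrite bigcup_mkcond.
  apply: (@countable_bigcupT_measurable _ (g_sigma_algebraType G)) => // q.
  by case: ifP => _; [exact: grG|exact: (@measurable0 _ (g_sigma_algebraType G))].
- move=> _ _ [a [b [ab ->]]] [a' [b' [ab' ->]]].
  by have [c [d [cd ->]]] := rV_box_setI ab ab'; exists c, d.
- move=> k; exists (const_mx (- k%:R)), (const_mx k%:R); split => // i.
  by rewrite !mxE ge0_cp.
- apply/seteqP; split => // x _.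
  exists (Num.truncn `|x|).+1 => // i; rewrite !mxE.
  suff : `|x ord0 i| < (Num.truncn `|x|).+1%:R.
    by rewrite ltr_norml => /andP[-> /ltW].
  by rewrite (le_lt_trans _ (truncnS_gt _))// normr_coord_le.
- move=> _ [a [b [ab ->]]]; rewrite mubox//; exact: lebesgue_rV_box.
- move=> k; rewrite [X in (X < _)%E]lebesgue_rV_box ?ltry// => i.
  by rewrite !mxE ge0_cp.
- by [].
Qed.

End boxes.

(** * Volumes under linear maps *)

Section linear_change_of_variables.
Context {R : realType}.

Lemma measurable_fun_mulmx n (M : 'M[R]_n) :
  measurable_fun [set: 'rV[R]_n] (fun x : 'rV[R]_n => x *m M).
Proof.
apply/measurable_fun_rVP => i.
under eq_fun do rewrite mxE.
apply: measurable_sum => j.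
by apply: measurable_funM => //; exact: measurable_coor.
Qed.

Lemma measurable_fun_addr_rV n (v : 'rV[R]_n) :
  measurable_fun [set: 'rV[R]_n] (fun x : 'rV[R]_n => x + v).
Proof.
apply/measurable_fun_rVP => i.
under eq_fun do rewrite mxE.
by apply: measurable_funD => //; exact: measurable_coor.
Qed.

Lemma lebesgue_rV_preimage n (T : 'rV[R]_n -> 'rV[R]_n) :
  measurable_fun setT T ->
  (forall a b : 'rV[R]_n, (forall i, a ord0 i <= b ord0 i) ->
    exists a' b' : 'rV[R]_n, [/\ forall i, a' ord0 i <= b' ord0 i,
      \prod_i (b' ord0 i - a' ord0 i) = \prod_i (b ord0 i - a ord0 i) &
      T @^-1` rV_box a b = rV_box a' b']) ->
  forall E, measurable E -> lebesgue_rV n (T @^-1` E) = lebesgue_rV n E.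
Proof.
move=> mT Tbox E mE; apply/esym.
apply: (lebesgue_rV_unique (mu :=
  measure_function_pushforward__canonical__measure_function_Measure
    (lebesgue_rV n) mT)) => // a b ab.
have [a' [b' [ab' <- Tab]]] := Tbox a b ab.
by rewrite /= /pushforward Tab -lebesgue_rV_box.
Qed.

Lemma lebesgue_rV_translate n (v : 'rV[R]_n) E : measurable E ->
  lebesgue_rV n ((fun x => x + v) @^-1` E) = lebesgue_rV n E.
Proof.
apply: lebesgue_rV_preimage; first exact: measurable_fun_addr_rV.
move=> a b ab; exists (a - v), (b - v); split => [i||].
- by rewrite !mxE lerD2r.
- by apply: eq_bigr => i _; rewrite !mxE; ring.
- apply/seteqP; split => x /= H i; have := H i; rewrite !mxE.
    by rewrite ltrBlDr lerBrDr.
  by rewrite ltrBlDr lerBrDr.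
Qed.

Lemma lebesgue_measure_affine (a s : R) (F : set (measurableTypeR R)) :
  a != 0 -> measurable F ->
  (`|a|%:E * lebesgue_measure ((fun t : measurableTypeR R => (a * t + s)%R : measurableTypeR R) @^-1` F) =
   lebesgue_measure F)%E.
Proof.
move=> a0 mF; apply/esym.
have mT : measurable_fun [set: measurableTypeR R]
    (fun t : measurableTypeR R => (a * t + s)%R : measurableTypeR R).
  by apply: measurable_funD => //; exact: measurable_funM.
have an : 0 <= `|a| by [].
apply: (lebesgue_measure_unique (mu := mscale (NngNum an)
   (measure_function_pushforward__canonical__measure_function_Measure
    lebesgue_measure mT))) => // _ [[p q] /= _ <-].
rewrite /mscale/= /pushforward lebesgue_measure_itv/= lte_fin.
have [agt|alt|aeq] := ltgtP 0 a; last by rewrite -aeq eqxx in a0.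
- rewrite (_ : _ @^-1` _ = `](p - s) / a, (q - s) / a]%classic); last first.
    apply/seteqP; split => t /=; rewrite !in_itv/=.
      by rewrite ltr_pdivrMr// ler_pdivlMr// ltrBlDr lerBrDr mulrC.
    by rewrite ltr_pdivrMr// ler_pdivlMr// ltrBlDr lerBrDr mulrC.
  rewrite lebesgue_measure_itv/= lte_fin ltr_pM2r ?invr_gt0// ltrD2r.
  by case: ifP => _; rewrite ?mule0// -EFinM gtr0_norm//; congr EFin; field.
- rewrite (_ : _ @^-1` _ = `[(q - s) / a, (p - s) / a[%classic); last first.
    apply/seteqP; split => t /=; rewrite !in_itv/= andbC.
      by rewrite ltr_ndivlMr// ler_ndivrMr// ltrBlDr lerBrDr mulrC.
    by rewrite ltr_ndivlMr// ler_ndivrMr// ltrBlDr lerBrDr mulrC.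
  rewrite lebesgue_measure_itv/= lte_fin ltr_nM2r ?invr_lt0// ltrD2r.
  by case: ifP => _; rewrite ?mule0// -EFinM ltr0_norm//; congr EFin; field.
Qed.

Lemma lebesgue_rVS1 n (E : set 'rV[R]_n.+1) : measurable E ->
  lebesgue_rV n.+1 E =
  (\int[lebesgue_measure]_t lebesgue_rV n [set y | E (cons_rV (t, y))])%E.
Proof.
move=> mE; rewrite /= /lebesgue_rV_step /pushforward.
apply: eq_integral => t _ /=; congr (lebesgue_rV n _).
by apply/seteqP; split => y; rewrite /xsection/= inE.
Qed.

(** Slicing in the other order: upper triangular factors act on the slices of [lebesgue_rVS1], lower
    triangular ones on these. *)
Lemma lebesgue_rVS2 n (E : set 'rV[R]_n.+1) : measurable E ->
  lebesgue_rV n.+1 E =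
  (\int[lebesgue_rV n]_y lebesgue_measure
     [set t : measurableTypeR R | E (cons_rV (t, y))])%E.
Proof.
move=> mE; rewrite /= /lebesgue_rV_step /pushforward.
have mE' : measurable (@cons_rV R n @^-1` E).
  by rewrite -[X in measurable X]setTI; exact: measurable_cons_rV.
rewrite (@product_measure_unique _ _ _ _ _ _ _
  (lebesgue_measure \x^ lebesgue_rV n)%E)//; last first.
  by move=> A B mA mB; rewrite /= product_measure2E.
apply: eq_integral => t _ /=; congr (lebesgue_measure _).
by apply/seteqP; split => y; rewrite /ysection/= inE.
Qed.

Lemma cons_rV_row_mx n (t : R) (y : 'rV[R]_n) :
  cons_rV (t, y) = row_mx t%:M y :> 'rV[R]_(1 + n).
Proof.
apply/rowP => i; rewrite /cons_rV !mxE.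
case: (unliftP ord0 i) => [j ->|->].
  have -> : lift ord0 j = rshift 1 j by exact/val_inj.
  by rewrite (unsplitK (inr _)).
have -> : ord0 = lshift n (ord0 : 'I_1) by exact/val_inj.
by rewrite (unsplitK (inl _)) !mxE eqxx.
Qed.

(** Stated with preimages, whose measurability is immediate and which compose well under products of
    matrices. *)
Definition scales_volume n (M : 'M[R]_n) := forall E, measurable E ->
  (`|\det M|%:E * lebesgue_rV n ((fun x => x *m M) @^-1` E) =
   lebesgue_rV n E)%E.

Lemma scales_volumeM n (M N : 'M[R]_n) :
  scales_volume M -> scales_volume N -> scales_volume (M *m N).
Proof.
move=> sM sN E mE; rewrite -(sN E mE) -(sM ((fun x => x *m N) @^-1` E));
  last first.
  by rewrite -[X in measurable X]setTI; exact: measurable_fun_mulmx.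
rewrite muleA -EFinM det_mulmx normrM [X in X%:E]mulrC; congr (_ * _)%E.
by congr (lebesgue_rV n _); apply/seteqP; split => x /=; rewrite mulmxA.
Qed.

Lemma scales_volume_tperm n (i j : 'I_n) : scales_volume (tperm_mx i j : 'M[R]_n).
Proof.
move=> E mE; rewrite /tperm_mx det_perm normrX normrN normr1 expr1n mul1e.
apply: lebesgue_rV_preimage => //; first exact: measurable_fun_mulmx.
have tE (x : 'rV[R]_n) k : (x *m tperm_mx i j) ord0 k = x ord0 (tperm i j k).
  by rewrite -xcolE mxE.
move=> a b ab; exists (a *m tperm_mx i j), (b *m tperm_mx i j); split.
- by move=> k; rewrite !tE.
- rewrite [RHS](reindex_inj (@perm_inj _ (tperm i j))).
  by apply: eq_bigr => k _; rewrite !tE.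
- apply/seteqP; split => x /= H k.
    by have := H (tperm i j k); rewrite !tE tpermK.
  by rewrite !tE; have := H (tperm i j k); rewrite !tE tpermK.
Qed.

(** The matrix sends (t, y) to (t, t b + y S): the slice at t undergoes [S] and a translation. *)
Lemma scales_volume_upper n (b : 'rV[R]_n) (S : 'M[R]_n) : scales_volume S ->
  scales_volume (block_mx 1%:M b 0 S : 'M[R]_(1 + n)).
Proof.
move=> sS E mE; rewrite det_ublock det1 mul1r.
have mE' : measurable ((fun x : 'rV[R]_(1 + n) => x *m block_mx 1%:M b 0 S) @^-1` E).
  by rewrite -[X in measurable X]setTI; exact: measurable_fun_mulmx.
rewrite !lebesgue_rVS1//.
have mcons (F : set 'rV[R]_n.+1) : measurable F ->
    measurable (@cons_rV R n @^-1` F).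
  by move=> mF; rewrite -[X in measurable X]setTI; exact: measurable_cons_rV.
have secE (F : set 'rV[R]_n.+1) (t : measurableTypeR R) :
    [set y | F (cons_rV (t, y))] = xsection (@cons_rV R n @^-1` F) t.
  by apply/seteqP; split => y; rewrite /xsection/= inE.
have mslice (F : set 'rV[R]_n.+1) (t : measurableTypeR R) : measurable F ->
    measurable [set y | F (cons_rV (t, y))].
  by move=> mF; rewrite secE; apply: measurable_xsection; exact: mcons.
rewrite -ge0_integralZl//; last first.
  under eq_fun do rewrite secE.
  exact: (measurable_fun_xsection (lebesgue_rV n) (mcons _ mE')).
apply: eq_integral => t _.
rewrite -(lebesgue_rV_translate (t *: b) (mslice _ t mE)).
rewrite -[RHS]sS; last first.
  by rewrite -[X in measurable X]setTI; exact: (measurable_fun_addr_rV (t *: b) measurableT (mslice _ t mE)).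
congr (_ * lebesgue_rV n _)%E; apply/seteqP; split => y /=;
  by rewrite !cons_rV_row_mx mul_row_block mulmx1 mulmx0 addr0 mul_scalar_mx addrC.
Qed.

(** The matrix sends (t, y) to (a t + y c, y): for fixed y this is an affine map of the line. *)
Lemma scales_volume_lower n (a : R) (c : 'cV[R]_n) : a != 0 ->
  scales_volume (block_mx a%:M 0 c 1%:M : 'M[R]_(1 + n)).
Proof.
move=> a0 E mE; rewrite det_lblock det1 mulr1 det_scalar expr1.
set M := block_mx _ _ _ _.
have mE' : measurable ((fun x : 'rV[R]_(1 + n) => x *m M) @^-1` E).
  by rewrite -[X in measurable X]setTI; exact: measurable_fun_mulmx.
rewrite !lebesgue_rVS2//.
have mcons (F : set 'rV[R]_n.+1) : measurable F ->
    measurable (@cons_rV R n @^-1` F).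
  by move=> mF; rewrite -[X in measurable X]setTI; exact: measurable_cons_rV.
have secE (F : set 'rV[R]_n.+1) (y : 'rV[R]_n) :
    [set t : measurableTypeR R | F (cons_rV (t, y))] =
    ysection (@cons_rV R n @^-1` F) y.
  by apply/seteqP; split => t; rewrite /ysection/= inE.
have mslice (F : set 'rV[R]_n.+1) (y : 'rV[R]_n) : measurable F ->
    measurable [set t : measurableTypeR R | F (cons_rV (t, y))].
  by move=> mF; rewrite secE; apply: measurable_ysection; exact: mcons.
rewrite -ge0_integralZl//; last first.
  under eq_fun do rewrite secE.
  exact: (measurable_fun_ysection lebesgue_measure (mcons _ mE')).
apply: eq_integral => y _.
rewrite -(lebesgue_measure_affine ((y *m c) ord0 ord0) a0 (mslice _ y mE)).
have yc := mx11_scalar (y *m c); set s := (y *m c) ord0 ord0 in yc *.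
suff eqM (t : R) : (cons_rV (t, y) : 'rV_(1 + n)) *m M = cons_rV (a * t + s, y).
  by congr (_ * lebesgue_measure _)%E; apply/seteqP; split => t /=; rewrite eqM.
rewrite !cons_rV_row_mx mul_row_block mulmx1 mulmx0 add0r mul_scalar_mx.
by rewrite scale_scalar_mx yc -raddfD/= mulrC.
Qed.

(** One step of Gaussian elimination per dimension: a row swap brings a nonzero pivot to the corner,
    and the block factorization leaves the Schur complement [S] for the induction. *)
Theorem scales_volume_unitmx n (M : 'M[R]_n) : M \in unitmx -> scales_volume M.
Proof.
elim: n => [|n IH] in M *.
  move=> _ E mE; rewrite det_mx00 normr1 mul1e; congr (lebesgue_rV 0 _).
  by apply/seteqP; split => x /=; rewrite (thinmx0 (x *m M)) (thinmx0 x).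
rewrite unitmxE unitfE => detM.
have [i Mi0] : exists i, M i ord0 != 0.
  apply/existsP; apply: contraNT detM; rewrite negb_exists => /forallP M0.
  rewrite (expand_det_col M ord0) big1// => i _.
  by move: (M0 i); rewrite negbK => /eqP ->; rewrite mul0r.
pose N : 'M[R]_(1 + n) := xrow i ord0 M.
have MN : M = tperm_mx i ord0 *m N.
  by rewrite /N xrowE mulmxA /tperm_mx -perm_mxM tperm2 perm_mx1 mul1mx.
have detN : \det N != 0.
  by move: detM; rewrite MN det_mulmx mulf_eq0 negb_or => /andP[].
pose a := N ord0 ord0; have a0 : a != 0 by rewrite /a /N mxE tpermR.
pose b := ursubmx N; pose c := dlsubmx N; pose D := drsubmx N.
have Na : ulsubmx N = a%:M.
  rewrite [LHS]mx11_scalar; congr (_%:M); rewrite [LHS]mxE [LHS]mxE /a.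
  by congr (N _ _); exact/val_inj.
pose S := D - a^-1 *: (c *m b).
have NE : N = block_mx a%:M 0 c 1%:M *m block_mx 1%:M (a^-1 *: b) 0 S.
  rewrite -[LHS]submxK Na -/b -/c -/D mulmx_block !mulmx0 !mul0mx !mulmx1 !mul1mx !addr0.
  rewrite mul_scalar_mx scalerA mulfV// scale1r.
  by rewrite /S -scalemxAr addrC subrK.
have uS : S \in unitmx.
  move: detN; rewrite NE det_mulmx det_ublock det1 mul1r mulf_eq0 negb_or.
  by move=> /andP[_]; rewrite unitmxE unitfE.
rewrite MN; apply: scales_volumeM; first exact: scales_volume_tperm.
rewrite NE; apply: scales_volumeM; first exact: scales_volume_lower.
by apply: scales_volume_upper; exact: IH.
Qed.

End linear_change_of_variables.

(** * Regularity of finite Borel measures *)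

Section measure_limits.
Context d (T : measurableType d) (R : realType).
Variable mu : {measure set T -> \bar R}.

Lemma nondecreasing_mu_le (F : (set T)^nat) M : (forall i, measurable (F i)) ->
  nondecreasing_seq F -> (forall i, mu (F i) <= M)%E ->
  (mu (\bigcup_n F n) <= M)%E.
Proof.
move=> mF ndF FM.
have cF := nondecreasing_cvg_mu (mu := mu) mF (bigcupT_measurable _ mF) ndF.
rewrite -(cvg_lim _ cF)//; apply: lime_le; first by apply/cvg_ex; eexists; exact: cF.
by near=> n => /=.
Unshelve. all: by end_near. Qed.

Lemma nonincreasing_mu_lt (F : (set T)^nat) (e : \bar R) : (mu (F 0%N) < +oo)%E ->
  (forall i, measurable (F i)) -> nonincreasing_seq F ->
  (mu (\bigcap_n F n) < e)%E -> exists n, (mu (F n) < e)%E.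
Proof.
move=> F0 mF niF Fe; apply: contrapT => /forallNP H.
have cF := nonincreasing_cvg_mu (mu := mu) F0 mF (bigcapT_measurable mF) niF.
suff : (e <= mu (\bigcap_n F n))%E by rewrite leNgt Fe.
rewrite -(cvg_lim _ cF)//; apply: lime_ge; first by apply/cvg_ex; eexists; exact: cF.
by near=> n => /=; rewrite leNgt; apply/negP; exact: H.
Unshelve. all: by end_near. Qed.

End measure_limits.

Section regularity.
Context {R : realType} (n : nat).
Local Notation V := 'rV[R]_n.

(** Closed sets increasing to U when U is open; they provide the inner approximation of open sets
    and, cut to bounded sets, their compact exhaustion. *)
Definition open_core (U : set V) (k : nat) : set V :=
  [set x | ball x k.+1%:R^-1 `<=` U].

Lemma closed_open_core U k : closed (open_core U k).
Proof.
rewrite -openC (_ : ~` _ = \bigcup_(y in ~` U) ball y k.+1%:R^-1).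
  by apply: bigcup_open => y _; exact: ball_open.
apply/seteqP; split => [x /existsNP[y /not_implyP[xy Uy]]|x [y Uy xy] H].
  by exists y => //; exact: ball_sym.
by apply: Uy; apply: H; exact: ball_sym.
Qed.

Lemma bigcup_open_core U : open U -> \bigcup_k open_core U k = U.
Proof.
move=> oU; apply/seteqP; split => [x [k _]|x Ux].
  by apply; exact: ballxx.
have /nbhs_ballP[e /= e0 eU] : nbhs x U by exact: open_nbhs_nbhs.
have [m me] := exists_grid_mesh e0.
exists m => // y xy; apply: eU; apply: le_ball xy.
by rewrite ltW// me.
Qed.

Lemma open_core_nd U : nondecreasing_seq (open_core U).
Proof.
move=> k l kl; apply/subsetPset => x H y xy; apply: H; apply: le_ball xy.
by rewrite lef_pV2 ?posrE// ler_nat.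
Qed.

(** The sets that can be approximated from both sides form a sigma-algebra containing the open sets.
    Asking for both sides at once is what makes the property stable under complements. *)
Lemma finite_measure_regular (mu : {measure set V -> \bar R}) (E : set V) (e : R) :
  (mu setT < +oo)%E -> measurable E -> 0 < e ->
  exists C U : set V, [/\ closed C, open U, C `<=` E, E `<=` U & (mu (U `\` C) < e%:E)%E].
Proof.
move=> muoo mE; move: e.
have mufin A : measurable A -> (mu A < +oo)%E.
  by move=> mA; rewrite (le_lt_trans _ muoo)// le_measure ?inE.
have mopen (U : set V) : open U -> measurable U by exact: open_measurable_rV.
have mclosed (C : set V) : closed C -> measurable C.
  by rewrite -openC => /mopen/measurableC; rewrite setCK.
pose P := [set E : set V | forall e : R, 0 < e ->
  exists C U : set V, [/\ closed C, open U, C `<=` E, E `<=` U & (mu (U `\` C) < e%:E)%E]].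
rewrite -/(P E); move: E mE; rewrite measurable_rV_borel.
apply: smallest_sub; first split => [|A PA|F PF].
- move=> e e0; exists set0, set0; split; [exact: closed0|exact: open0|by []|by []|].
  by rewrite setD0 measure0 lte_fin.
- rewrite setTD => e e0; have [C [U [cC oU CA AU Ce]]] := PA e e0.
  exists (~` U), (~` C); split.
  + exact: open_closedC.
  + exact: closed_openC.
  + exact: subsetC.
  + exact: subsetC.
  + by rewrite setDE setCK setIC -setDE.
- move=> e e0.
  (* The errors add up to at most e / 2, which leaves a strict inequality with e. *)
  have e2 i : 0 < e / 2 / (2 ^ i.+1)%:R :> R by rewrite !divr_gt0.
  have /choice[C /choice[U CU]] : forall i, exists C U : set V, [/\ closed C, open U,
      C `<=` F i, F i `<=` U & (mu (U `\` C) < (e / 2 / (2 ^ i.+1)%:R)%:E)%E].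
    by move=> i; exact: PF.
  pose W := \bigcup_i U i.
  have oW : open W by apply: bigcup_open => i _; have [] := CU i.
  have mC i : measurable (C i) by apply: mclosed; have [] := CU i.
  have mU i : measurable (U i) by apply: mopen; have [] := CU i.
  (* An infinite union of closed sets need not be closed, so only the first [N] of the [C i] are
     kept; continuity from above supplies [N]. *)
  pose D N := W `\` \big[setU/set0]_(i < N) C i.
  have mD N : measurable (D N).
    by apply: measurableD; [exact: mopen|exact: bigsetU_measurable].
  have niD : nonincreasing_seq D.
    by move=> k l kl; apply/subsetPset; apply: setDS; exact: subset_bigsetU.
  have [|N DN] := @nonincreasing_mu_lt _ _ _ mu D e%:E (mufin _ (mD 0%N)) mD niD.
    apply: (@le_lt_trans _ _ (e / 2)%:E); last by rewrite lte_fin ltr_pdivrMr// ltr_pMr// ltr1n.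
    apply: (le_trans _ (@epsilon_trick0 R (e / 2) xpredT _)); last by rewrite divr_ge0// ltW.
    apply: (@le_trans _ _ (\sum_(i <oo) mu (U i `\` C i))%E); last first.
      by apply: lee_nneseries => // i _; apply: ltW; have [] := CU i.
    apply: measure_sigma_subadditive => //.
    - by move=> i; exact: measurableD.
    - exact: bigcapT_measurable.
    - move=> x DX; have [i _ Uix] : W x by have [] := DX 0%N I.
      exists i => //; split => // Cix.
      by have [_] := DX i.+1 I; apply; rewrite -bigcup_mkord; exists i => /=.
  exists (\big[setU/set0]_(i < N) C i), W; split => //.
  + by apply: closed_bigsetU => i _; have [] := CU i.
  + rewrite -bigcup_mkord => x [i _ Cx]; exists i => //.
    by have [_ _ + _ _] := CU i; apply.
  + by move=> x [i _ Fx]; exists i => //; have [_ _ _ + _] := CU i; apply.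
- move=> U oU e e0.
  pose D k := U `\` open_core U k.
  have mD k : measurable (D k).
    by apply: measurableD; [exact: mopen|apply: mclosed; exact: closed_open_core].
  have [||N DN] := @nonincreasing_mu_lt _ _ _ mu D e%:E (mufin _ (mD 0%N)) mD.
  + by move=> k l kl; apply/subsetPset; apply: setDS; apply/subsetPset/open_core_nd.
  + rewrite (_ : \bigcap_k D k = set0) ?measure0 ?lte_fin//.
    rewrite -subset0 => x DX; have [Ux _] := DX 0%N I.
    move: (Ux); rewrite -(bigcup_open_core oU) => -[k _ kx].
    by have [_] := DX k I; apply.
  exists (open_core U N), U; split => //; first exact: closed_open_core.
  by move=> x; apply; exact: ballxx.
Qed.

Lemma finite_measure_outer_regular (mu : {measure set V -> \bar R}) (E : set V) (e : R) :
  (mu setT < +oo)%E -> measurable E -> 0 < e ->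
  exists U : set V, [/\ open U, E `<=` U & (mu U <= mu E + e%:E)%E].
Proof.
move=> muoo mE e0.
have [C [U [cC oU CE EU UCe]]] := finite_measure_regular muoo mE e0.
have mU : measurable U by exact: open_measurable_rV.
have mC : measurable C.
  by move: cC; rewrite -openC => /open_measurable_rV/measurableC; rewrite setCK.
exists U; split => //.
rewrite (measureDI mu mU mC) addeC leeD//; last exact: ltW.
by apply: le_measure; rewrite ?inE//; [exact: measurableI|move=> x [_ /CE]].
Qed.

End regularity.

(** * Volumes under Lipschitz maps *)

Section lipschitz_images.
Context {R : realType} (n : nat).
Local Notation V := 'rV[R]_n.
Local Notation lambda := (lebesgue_rV n : set 'rV[R]_n -> \bar R).

(** The cells of one mesh as a sequence, for countable additivity; numbers that encode no cell give
    the empty set. *)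
Definition grid_seq m (j : nat) : set V :=
  if pickle_inv j is Some k then grid (m, k) else set0.

Lemma measurable_grid_seq m j : measurable (grid_seq m j).
Proof. by rewrite /grid_seq; case: pickle_inv => [k|//]; exact: measurable_grid. Qed.

Lemma grid_seq_cover m x : exists j, grid_seq m j x.
Proof.
have [k xk] := grid_cover m x.
by exists (pickle k); rewrite /grid_seq pickleK_inv.
Qed.

Lemma grid_seq_inj m i j x : grid_seq m i x -> grid_seq m j x -> i = j.
Proof.
rewrite /grid_seq; have := @pickle_invK 'rV[int]_n i; case: pickle_inv => //= k ik.
have := @pickle_invK 'rV[int]_n j; case: pickle_inv => //= l jl xk xl.
by rewrite -ik -jl (grid_inj xk xl).
Qed.

Lemma grid_seq_close m j x y : grid_seq m j x -> grid_seq m j y ->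
  `|x - y| <= m.+1%:R^-1.
Proof. by rewrite /grid_seq; case: pickle_inv => // k; exact: grid_close. Qed.

Lemma lebesgue_grid q : lambda (grid q) = (q.1.+1%:R^-1 ^+ n)%:E.
Proof.
rewrite [LHS]lebesgue_rV_box => [|i].
  under eq_bigr do rewrite !mxE.
  rewrite (eq_bigr (fun=> q.1.+1%:R^-1)) => [|i _]; last by ring.
  by rewrite prodr_const card_ord.
by rewrite !mxE ler_pdivrMr// divfK// lerDl.
Qed.

Lemma lebesgue_rV_ball_lty (r : R) : 0 <= r -> (lambda (ball (0%R : V) r) < +oo)%E.
Proof.
move=> r0; apply: (@le_lt_trans _ _ (lambda (rV_box (const_mx (- r)) (const_mx r)))).
  apply: le_measure; rewrite ?inE//; last 1 first.
  - move=> x; rewrite -ball_normE/= sub0r normrN => xr i; rewrite !mxE.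
    have := le_lt_trans (normr_coord_le x i) xr.
    by rewrite ltr_norml => /andP[-> /ltW].
  - by apply: open_measurable_rV; exact: ball_open.
  - exact: measurable_rV_box.
rewrite [X in (X < _)%E]lebesgue_rV_box ?ltry// => i.
by rewrite !mxE ge0_cp.
Qed.

(** In each coordinate A lies between its infimum and the infimum plus w. The boxes leave out their
    left faces, so the interval is extended to the left by w' - w. *)
Lemma small_diameter_volume (A : set V) (w w' : R) : measurable A ->
  0 <= w -> w < w' -> (forall x y, A x -> A y -> `|x - y| <= w) ->
  (lambda A <= (w' ^+ n)%:E)%E.
Proof.
move=> mA w0 ww' Aw.
have [[x0 Ax0]|] := pselect (A !=set0); last first.
  move=> /set0P/negP; rewrite negbK => /eqP ->; rewrite measure0 lee_fin exprn_ge0//.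
  by rewrite (le_trans w0)// ltW.
pose a i := inf [set x ord0 i | x in A].
have hi i : has_inf [set x ord0 i | x in A].
  split; first by exists (x0 ord0 i), x0.
  exists (x0 ord0 i - w) => _ [x Ax <-].
  have := le_trans (le_trans (ler_norm _) (normr_coord_le (x0 - x) i)) (Aw _ _ Ax0 Ax).
  by rewrite !mxE; lra.
pose p : V := \row_i (a i - (w' - w)); pose q : V := \row_i (a i + w).
have pq : (forall i, p ord0 i <= q ord0 i) by move=> i; rewrite !mxE; lra.
have Apq : A `<=` rV_box p q.
  move=> x Ax i; rewrite !mxE; apply/andP; split.
    have : a i <= x ord0 i by apply: ge_inf; [exact: (hi i).2|exists x].
    by lra.
  rewrite -lerBlDr; apply: lb_le_inf; first exact: (hi i).1.
  move=> _ [y Ay <-].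
  have := le_trans (le_trans (ler_norm _) (normr_coord_le (x - y) i)) (Aw _ _ Ax Ay).
  by rewrite !mxE; lra.
apply: (@le_trans _ _ (lambda (rV_box p q))).
  by apply: le_measure; rewrite ?inE//; exact: measurable_rV_box.
rewrite [X in (X <= _)%E]lebesgue_rV_box// lee_fin.
under eq_bigr do rewrite !mxE.
rewrite (eq_bigr (fun=> w')) => [|i _]; last by ring.
by rewrite prodr_const card_ord.
Qed.

(** The cells of one mesh inside U are disjoint, so their volumes add up to at most that of U, and
    the image of a cell of side h has diameter at most L h, hence volume at most (L' h)^n. *)
Lemma lipschitz_volume_open (s U : set V) (g : V -> V) (L L' : R) :
  0 <= L -> L < L' ->
  (forall x y, s x -> s y -> `|g x - g y| <= L * `|x - y|) ->
  (forall W, measurable W -> measurable (g @` (s `&` W))) ->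
  open U -> s `<=` U -> (lambda (g @` s) <= (L' ^+ n)%:E * lambda U)%E.
Proof.
move=> L0 LL' gL mg oU sU.
have L'0 : 0 <= L' by rewrite (le_trans L0)// ltW.
have mU : measurable U by exact: open_measurable_rV.
pose F m j := if `[< grid_seq m j `<=` U >] then grid_seq m j else set0.
have mF m j : measurable (F m j).
  by rewrite /F; case: ifP => // _; exact: measurable_grid_seq.
have FG m j : F m j `<=` grid_seq m j 
  by rewrite /F; case: asboolP => _; [exact: subset_refl|exact: sub0set].
pose Um m := \bigcup_j F m j.
have mUm m : measurable (Um m) by exact: bigcupT_measurable.
have Um_le m : (lambda (g @` (s `&` Um m)) <= (L' ^+ n)%:E * lambda U)%E.
  apply: (@le_trans _ _ (\sum_(j <oo) lambda (g @` (s `&` F m j)))%E).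
    apply: (@measure_sigma_subadditive _ _ _ (lebesgue_rV n)) => [j||].
    - exact: mg.
    - exact: mg.
    - by move=> _ [x [sx [j _ Fx]] <-]; exists j => //; exists x.
  apply: (@le_trans _ _ (\sum_(j <oo) (L' ^+ n)%:E * lambda (F m j))%E).
    apply: lee_nneseries => // j _.
    rewrite /F; case: ifP => _; last by rewrite setI0 image_set0 !measure0 mule0.
    rewrite /grid_seq; case E : (pickle_inv j) => [k|]; last first.
      by rewrite setI0 image_set0 !measure0 mule0.
    rewrite lebesgue_grid/= -EFinM -exprMn.
    have h0 : 0 < m.+1%:R^-1 :> R by rewrite invr_gt0.
    apply: (@small_diameter_volume _ (L * m.+1%:R^-1)).
    - by apply: mg; exact: measurable_grid.
    - by rewrite mulr_ge0// ltW.
    - by rewrite ltr_pM2r.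
    - move=> _ _ [x [sx xk] <-] [y [sy yk] <-].
      rewrite (le_trans (gL _ _ sx sy))// ler_wpM2l//.
      exact: grid_close xk yk.
  rewrite nneseriesZl//.
  rewrite lee_wpmul2l ?lee_fin ?exprn_ge0//.
  rewrite -(measure_semi_bigcup _ (mF m)); last exact: mUm.
    apply: le_measure; rewrite ?inE; [exact: mUm|exact: mU|].
    by rewrite /F => x [j _]; case: ifP => // /asboolP; apply.
  apply/trivIsetP => i j _ _ ij; rewrite -subset0 => x [].
  by move=> /FG xi /FG xj; rewrite (grid_seq_inj xi xj) eqxx in ij.
(* The sets [Um m] of different meshes need not be nested. The points covered at every mesh from N
   on do increase with N, and every point of U is eventually among them. *)
pose W N := \bigcap_(m in [set m | (N <= m)%N]) Um m.
have mW N : measurable (W N).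
  by apply: bigcap_measurableType => k _; exact: mUm.
have sW : g @` s = \bigcup_N g @` (s `&` W N).
  rewrite -image_bigcup -setI_bigcupr; congr (image _ g).
  apply/esym/setIidPl => x /sU Ux.
  have /nbhs_ballP[e /= e0 eU] : nbhs x U by exact: open_nbhs_nbhs.
  have [N Ne] := exists_grid_mesh e0.
  exists N => // m /= Nm; have [j xj] := grid_seq_cover m x.
  exists j => //; rewrite /F; case: asboolP => // H; case: H => y yj; apply: eU.
  by rewrite -ball_normE/= (le_lt_trans (grid_seq_close xj yj))// Ne.
rewrite sW; apply: nondecreasing_mu_le.
- by move=> N; exact: mg.
- move=> N M NM; apply/subsetPset; apply: image_subset; apply: setIS => x Wx m /= Mm.
  by apply: Wx => /=; exact: leq_trans Mm.
- move=> N; apply: le_trans (Um_le N); apply: le_measure; rewrite ?inE.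
  + exact: mg.
  + exact: mg.
  + by apply: image_subset; apply: setIS => x; apply => /=.
Qed.

(** Outer regularity replaces [s] by an open set of almost the same volume. It is available for
    finite measures, hence the exhaustion by balls and the restricted measure. *)
Theorem lipschitz_volume (s : set V) (g : V -> V) (L L' : R) : measurable s ->
  0 <= L -> L < L' ->
  (forall x y, s x -> s y -> `|g x - g y| <= L * `|x - y|) ->
  (forall W, measurable W -> measurable (g @` (s `&` W))) ->
  (lambda (g @` s) <= (L' ^+ n)%:E * lambda s)%E.
Proof.
move=> ms L0 LL' gL mg.
have L'0 : 0 <= L' by rewrite (le_trans L0)// ltW.
pose B k : set V := ball 0 k.+1%:R.
have mB k : measurable (B k) by apply: open_measurable_rV; exact: ball_open.
have sB : g @` s = \bigcup_k g @` (s `&` B k).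
  rewrite -image_bigcup -setI_bigcupr; congr (image _ g).
  apply/esym/setIidPl => x _; exists (Num.truncn `|x|) => //.
  by rewrite /B -ball_normE/= sub0r normrN truncnS_gt.
rewrite sB; apply: nondecreasing_mu_le.
- by move=> k; exact: mg.
- move=> k l kl; apply/subsetPset; apply: image_subset; apply: setIS.
  by apply: le_ball; rewrite ler_nat.
move=> k; apply: (@le_trans _ _ ((L' ^+ n)%:E * lambda (s `&` B k))%E); last first.
  rewrite lee_wpmul2l ?lee_fin ?exprn_ge0//.
  by apply: le_measure; rewrite ?inE//; exact: measurableI.
have Boo : (lambda (B k) < +oo)%E by exact: lebesgue_rV_ball_lty.
apply/lee_addgt0Pr => e e0.
have Ln0 : 0 <= L' ^+ n by rewrite exprn_ge0.
have Lp : 0 < L' ^+ n + 1 by rewrite ltr_wpDl.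
have [||U [oU sU Ue]] := @finite_measure_outer_regular R n
   (mrestr (lebesgue_rV n) (mB k)) s (e / (L' ^+ n + 1)) _ ms.
- by rewrite /= /mrestr setTI.
- by rewrite divr_gt0.
have mU : measurable U by exact: open_measurable_rV.
apply: (@le_trans _ _ ((L' ^+ n)%:E * lambda (U `&` B k))%E).
  apply: (@lipschitz_volume_open _ _ _ L) => //.
  - by move=> x y [sx _] [sy _]; exact: gL.
  - by move=> W mW; rewrite -setIA; apply: mg; exact: measurableI.
  - by apply: openI => //; exact: ball_open.
  - exact: setSI.
apply: (@le_trans _ _ ((L' ^+ n)%:E * (lambda (s `&` B k) + (e / (L' ^+ n + 1))%:E))%E).
  by rewrite lee_wpmul2l ?lee_fin.
rewrite ge0_muleDr ?lee_fin ?divr_ge0 ?(ltW e0) ?(ltW Lp)//.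
rewrite leeD2l// -EFinM lee_fin mulrA ler_pdivrMr// mulrC ler_pM2l//.
by rewrite lerDl.
Qed.

End lipschitz_images.

(** * Images of Borel sets *)

Section continuous_measurability.
Context {R : realType} (n : nat).
Local Notation V := 'rV[R]_n.
Variable B : set V.
Hypothesis oB : open B.

Lemma open_preimage_in (W : topologicalType) (f : V -> W) (O : set W) :
  {in B, continuous f} -> open O -> open (B `&` f @^-1` O).
Proof.
move=> cf oO; rewrite openE => x [Bx Ox]; apply: filterI.
  by apply: open_nbhs_nbhs; split.
have : nbhs (f x) O by apply: open_nbhs_nbhs; split.
by move/(cf x _); apply; rewrite inE.
Qed.

Lemma continuous_in_measurable_fun (f : V -> R) :
  {in B, continuous f} -> measurable_fun B (f : V -> measurableTypeR R).
Proof.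
move=> cf; apply: (@measurability _ _ _ _ _ _ (RGenOpens.G (R := R))).
  exact: RGenOpens.measurableE.
move=> _ [_ [a [b ->]] <-]; apply: open_measurable_rV.
by apply: open_preimage_in => //; exact: interval_open.
Qed.

Lemma continuous_in_measurable_fun_rV m (f : V -> 'rV[R]_m) :
  {in B, continuous f} -> measurable_fun B f.
Proof.
move=> cf; apply: (@measurability _ _ _ _ _ _ (@open 'rV[R]_m)).
  exact: measurable_rV_borel.
move=> _ [U oU <-]; apply: open_measurable_rV.
exact: open_preimage_in.
Qed.

Variable f : V -> V.
Hypothesis cf : {in B, continuous f}.
Hypothesis injf : {in B &, injective f}.
Hypothesis mfB : measurable (f @` B).

(* An open set is sigma-compact, and by injectivity images commute with
   complements in B. *)
Lemma measurable_image (E : set V) : measurable E -> E `<=` B ->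
  measurable (f @` E).
Proof.
move=> mE EB.
suff : <<s @open V >> `<=` [set F | measurable (f @` (F `&` B))].
  by rewrite -measurable_rV_borel => /(_ E mE); rewrite /= setIidl.
apply: smallest_sub; first split.
- by rewrite /= set0I image_set0; exact: measurable0.
- move=> F /= mF.
  rewrite (_ : f @` _ = f @` B `\` f @` (F `&` B)); first exact: measurableD.
  apply/seteqP; split => [_ [x [[_ Fx] Bx] <-]|_ [[x Bx <-] H]].
    split; first by exists x.
    move=> [y [Fy By] yx]; apply: Fx.
    by rewrite -(injf _ _ yx) ?inE.
  by exists x => //; split => //; split => // Fx; apply: H; exists x.
- move=> F mF; rewrite /= setI_bigcupl image_bigcup.
  exact: bigcupT_measurable.
- move=> U oU /=.
  have oUB : open (U `&` B) by exact: openI.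
  pose K k := open_core (U `&` B) k `&` [set x | `|x| <= k%:R].
  have KE : U `&` B = \bigcup_k K k.
    apply/seteqP; split => [x UBx|x [k _ [+ _]]]; last by apply; exact: ballxx.
    move: (UBx); rewrite -(bigcup_open_core oUB) => -[k _ kx].
    exists (maxn k (Num.truncn `|x|).+1) => //; split.
      by move: kx; apply/subsetPset/open_core_nd/leq_maxl.
    rewrite /= (le_trans (ltW (truncnS_gt _)))// ler_nat; exact: leq_maxr.
  rewrite KE image_bigcup; apply: bigcupT_measurable => k.
  have KB : K k `<=` B.
    by move=> x Kx; have [] : (U `&` B) x by rewrite KE; exists k.
  suff : closed (f @` K k).
    by rewrite -openC => /open_measurable_rV/measurableC; rewrite setCK.
  apply: compact_closed; first exact: norm_hausdorff.
  apply: continuous_compact.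
    apply: continuous_in_subspaceT => x; rewrite inE => Kx.
    by apply: cf; rewrite inE; exact: KB.
  apply: bounded_closed_compact.
    exists k%:R; split; first exact: num_real.
    by move=> M kM x [_ /= xk]; rewrite (le_trans xk)// ltW.
  apply: closedI; first exact: closed_open_core.
  rewrite -[X in closed X]/((fun x : V => `|x|) @^-1` [set r | r <= k%:R]).
  apply: preimage_closed => [x _|]; last exact: closed_le.
  exact: norm_continuous.
Qed.

End continuous_measurability.

(** * Strict differentiability *)

Section strict_differentiability.
Context {R : realType}.

Lemma norm_mulmx_le m n (v : 'rV[R]_m) (N : 'M[R]_(m, n)) :
  `|v *m N| <= m%:R * `|N| * `|v|.
Proof.
rewrite [leLHS]mx_normrE; apply/bigmax_leP; split => [|[i j] _] /=.
  by rewrite !mulr_ge0.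
rewrite ord1 mxE (le_trans (ler_norm_sum _ _ _))//.
rewrite -mulrA -[X in X%:R](card_ord m) -sum1_card natr_sum mulr_suml.
apply: ler_sum => k _; rewrite mul1r normrM mulrC ler_pM ?normr_coord_le//.
rewrite [leRHS]mx_normrE.
exact: (le_bigmax_cond _ (fun i : 'I_m * 'I_n => `|N i.1 i.2|) (j := (k, j))).
Qed.

Lemma is_derive_line n (F : 'rV[R]_n -> R) (z v : 'rV[R]_n) (t : R) :
  derivable F (z + t *: v) v ->
  is_derive t 1 (fun s : R => F (z + s *: v)) ('D_v F (z + t *: v)).
Proof.
have E : (fun h : R => h^-1 *: (((fun s : R => F (z + s *: v)) \o shift t) (h *: 1) -
      F (z + t *: v))) =
    (fun h : R => h^-1 *: ((F \o shift (z + t *: v)) (h *: v) - F (z + t *: v))).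
  apply/funext => h /=; congr (_ *: (F _ - _)).
  by rewrite -[h *: 1]/(h * 1) mulr1 scalerDl addrCA.
move=> dF; apply: DeriveDef; first by rewrite /derivable E.
by rewrite /derive E.
Qed.

(** Lipschitz bounds need the derivative at x to control all pairs y, z near x, not only the pairs
    with z = x. This comes from the mean value theorem on the segment from z to y, applied to each
    coordinate of phi minus its linear part. *)
Lemma C1_strict_differentiable n (B : set 'rV[R]_n) (phi : 'rV[R]_n -> 'rV[R]_n) x (delta : R) :
  open B -> C1_on B phi -> B x -> 0 < delta ->
  exists e : R, [/\ 0 < e, ball x e `<=` B &
    forall y z, ball x e y -> ball x e z ->
      `|(phi y - phi z) - (y - z) *m 'J phi x| <= delta * `|y - z|].
Proof.
move=> oB [dphi + Bx d0]; rewrite continuous_open_subspace// => cJ.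
(* This compensates the factor n of [norm_mulmx_le]; the successor avoids a division by 0 in
   dimension 0. *)
have dn0 : 0 < delta / n.+1%:R by rewrite divr_gt0.
have /cvgrPdist_lt/(_ _ dn0) cJx : 'J phi w @[w --> x] --> 'J phi x.
  by apply: cJ; rewrite inE.
have : \forall w \near x, B w /\ `|'J phi x - 'J phi w| < delta / n.+1%:R.
  near=> w; split; last by near: w.
  by near: w; apply: open_nbhs_nbhs.
move=> /nbhs_ballP[e /= e0 eB]; exists e; split=> // [w /eB[]//|y z xy xz].
pose v := y - z.
rewrite [leLHS]mx_normrE; apply/bigmax_leP; split => [|[i j] _] /=.
  by rewrite mulr_ge0// ltW.
rewrite ord1 {i}.
have line (t : R) : 0 <= t <= 1 -> ball x e (z + t *: v).
  move=> /andP[t0 t1]; move: xy xz; rewrite -!ball_normE/= => xy xz.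
  have -> : x - (z + t *: v) = t *: (x - y) + (1 - t) *: (x - z).
    by apply/rowP => k; rewrite !mxE; ring.
  rewrite (le_lt_trans (ler_normD _ _))// !normrZ (ger0_norm t0) ger0_norm ?subr_ge0//.
  have [->|tn0] := eqVneq t 0; first by rewrite mul0r add0r subr0 mul1r.
  have tp : 0 < t by rewrite lt_def tn0.
  have : t * `|x - y| < t * e by rewrite ltr_pM2l.
  have : (1 - t) * `|x - z| <= (1 - t) * e by rewrite ler_wpM2l ?subr_ge0// ltW.
  by lra.
pose F (w : 'rV[R]_n) : R := phi w ord0 j.
pose g (t : R) := F (z + t *: v) - t * (v *m 'J phi x) ord0 j.
pose dg (t : R) : R := (v *m ('J phi (z + t *: v) - 'J phi x)) ord0 j.
have subE (a b : 'rV[R]_n) : (a - b) ord0 j = a ord0 j - b ord0 j by rewrite !mxE.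
have dgP (t : R) : 0 <= t <= 1 -> is_derive t 1 g (dg t).
  move=> /line/eB[Bw _].
  have dw : derivable phi (z + t *: v) v by apply: diff_derivable; exact: dphi.
  have dFw : derivable F (z + t *: v) v by move/derivable_mxP : (dw) => /(_ ord0 j).
  have -> : dg t = 'D_v F (z + t *: v) - (v *m 'J phi x) ord0 j.
    rewrite /dg mulmxBr subE; congr (_ - _).
    have /esym dE := deriveEjacobian v (dphi _ Bw).
    rewrite [LHS](congr1 (fun M : 'rV[R]_n => M ord0 j) dE).
    by rewrite (derive_mx dw) [LHS]mxE.
  apply: is_deriveB; first exact: is_derive_line.
  have -> : (fun t : R => t * (v *m 'J phi x) ord0 j) = (v *m 'J phi x) ord0 j \*: (id : R -> R).
    by apply/funext => s /=; rewrite mulrC.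
  by apply: is_derive_eq; rewrite /= -[RHS]mulr1.
have [||c c01] := @MVT R g dg 0 1 ltr01.
- by move=> t; rewrite in_itv/= => /andP[t0 t1]; apply: dgP; rewrite !ltW.
- apply: continuous_in_subspaceT => t; rewrite inE/= in_itv/= => t01.
  have := dgP t t01 => -[dt _].
  by apply: differentiable_continuous; apply/derivable1_diffP.
have -> : g 1 - g 0 = (phi y - phi z - (y - z) *m 'J phi x) ord0 j.
  by rewrite /g /F scale1r scale0r addr0 mul0r mul1r subr0 [z + _]addrC subrK !subE addrAC.
rewrite subr0 mulr1 => ->.
rewrite (le_trans (normr_coord_le _ _))// (le_trans (norm_mulmx_le _ _))//.
apply: ler_wpM2r => //.
have /line/eB[_ /ltW Jw] : 0 <= c <= 1.
  by move: c01; rewrite in_itv/= => /andP[? ?]; rewrite !ltW.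
rewrite distrC (le_trans (ler_wpM2l _ Jw))// mulrCA ler_piMr//; first exact: ltW.
by rewrite ler_pdivrMr// mul1r ler_nat.
Unshelve. all: by end_near. Qed.

End strict_differentiability.

(** * Volumes under C1 bijections *)

Lemma continuous_det (R : realType) n : continuous (fun M : 'M[R]_n => \det M : R).
Proof.
apply: (@continuous_big R _ +%R 0 xpredT); first exact: (@add_continuous R^o).
move=> s _ M.
apply: (@continuousM R _ (fun=> (-1) ^+ s) (fun x : 'M[R]_n => \prod_i x i (s i)) M).
  exact: cst_continuous.
apply: (@continuous_big R _ *%R 1 xpredT); first exact: mul_continuous.
by move=> i _; exact: coord_continuous.
Qed.

Section image_volume.
Context {R : realType} (n : nat).
Local Notation V := 'rV[R]_n.
Local Notation lambda := (lebesgue_rV n : set 'rV[R]_n -> \bar R).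
Variables (A B : set V) (phi : V -> V).
Hypotheses (oA : open A) (oB : open B) (bij : set_bij B A phi) (C1 : C1_on B phi).

Definition jac (x : V) : R := `|\det ('J phi x)|.

Lemma jac_ge0 x : 0 <= jac x. Proof. exact: normr_ge0. Qed.

Lemma C1_on_continuous : {in B, continuous phi}.
Proof.
by move=> x; rewrite inE => Bx; apply: differentiable_continuous; exact: (C1.1 x Bx).
Qed.

Lemma set_bij_injective : {in B &, injective phi}.
Proof. by case: bij. Qed.

Lemma set_bij_image : phi @` B = A.
Proof. by case: bij => fBA _ sBA; apply: surj_image_eq => //; exact/image_subP. Qed.

Lemma measurable_C1_image E : measurable E -> E `<=` B -> measurable (phi @` E).
Proof.
apply: measurable_image => //; first exact: C1_on_continuous.
  exact: set_bij_injective.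
by rewrite set_bij_image; exact: open_measurable_rV.
Qed.

Lemma measurable_C1_preimage E W : measurable E -> E `<=` B -> measurable W ->
  measurable (E `&` phi @^-1` W).
Proof.
move=> mE EB mW.
have mB : measurable B by exact: open_measurable_rV.
rewrite -(setIidl EB) -setIA; apply: measurableI => //.
exact: (continuous_in_measurable_fun_rV oB C1_on_continuous).
Qed.

Lemma continuous_jac : {in B, continuous jac}.
Proof.
have [_] := C1; rewrite continuous_open_subspace// => cJ x xB.
apply: (@continuous_comp _ _ _ (fun w => 'J phi w) (fun M : 'M[R]_n => `|\det M|)).
  exact: cJ.
apply: (@continuous_comp _ _ _ (fun M : 'M[R]_n => \det M : R^o) (fun r => `|r|)).
  exact: continuous_det.
exact: norm_continuous.
Qed.

Lemma measurable_jac : measurable_fun B (jac : V -> measurableTypeR R).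
Proof. exact: continuous_in_measurable_fun continuous_jac. Qed.

Lemma measurable_mulmx_preimage (N : 'M[R]_n) (E : set V) : measurable E ->
  measurable ((fun x => x *m N) @^-1` E).
Proof. by move=> mE; rewrite -[X in measurable X]setTI; exact: measurable_fun_mulmx. Qed.

Lemma image_mulmx (N : 'M[R]_n) (E : set V) : N \in unitmx ->
  (fun x => x *m N) @` E = (fun x => x *m invmx N) @^-1` E.
Proof.
move=> uN; apply/seteqP; split => [_ [x Ex <-]|x Ex] /=; first by rewrite mulmxK.
by exists (x *m invmx N) => //; rewrite mulmxKV.
Qed.

Lemma image_volume_mulmx (N : 'M[R]_n) E : N \in unitmx -> measurable E ->
  lambda ((fun x => x *m N) @` E) = (`|\det N|%:E * lambda E)%E.
Proof.
move=> uN mE; rewrite image_mulmx//.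
have uN' : invmx N \in unitmx by rewrite unitmx_inv.
rewrite -[in RHS](scales_volume_unitmx uN' mE) det_inv muleA -EFinM -normrM.
by rewrite mulfV ?normr1 ?mul1e//; move: uN; rewrite unitmxE unitfE.
Qed.

(** Here [phi] followed by [N] is Lipschitz, while the effect of [N] on volumes is known exactly.
    [N] is left free: it will be the inverse derivative at regular points and a stretching at
    critical ones. *)
Lemma image_volume_upper (N : 'M[R]_n) E (L L' : R) : N \in unitmx ->
  measurable E -> E `<=` B -> 0 <= L -> L < L' ->
  (forall y z, E y -> E z -> `|(phi y - phi z) *m N| <= L * `|y - z|) ->
  (`|\det N|%:E * lambda (phi @` E) <= (L' ^+ n)%:E * lambda E)%E.
Proof.
move=> uN mE EB L0 LL' HL.
rewrite -image_volume_mulmx//; last exact: measurable_C1_image.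
rewrite image_comp; apply: (lipschitz_volume mE L0 LL').
  by move=> y z Ey Ez /=; rewrite -mulmxBl; exact: HL.
move=> W mW; rewrite -image_comp image_mulmx//.
apply: measurable_mulmx_preimage; apply: measurable_C1_image.
  exact: measurableI.
by move=> x [/EB].
Qed.

(** The hypothesis says that the map [h], which undoes [phi] followed by [N], is Lipschitz on the
    image of E. *)
Lemma image_volume_lower (N : 'M[R]_n) E (L L' : R) : N \in unitmx ->
  measurable E -> E `<=` B -> 0 <= L -> L < L' ->
  (forall y z, E y -> E z -> `|y - z| <= L * `|(phi y - phi z) *m N|) ->
  (lambda E <= (L' ^+ n * `|\det N|)%:E * lambda (phi @` E))%E.
Proof.
move=> uN mE EB L0 LL' HL.
have mphiE : measurable (phi @` E) by exact: measurable_C1_image.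
have /choice[psi psiK] : forall w, exists x, (phi @` E) w -> E x /\ phi x = w.
  move=> w; have [[x Ex <-]|nw] := pselect ((phi @` E) w); first by exists x.
  by exists 0 => /nw.
pose h w := psi (w *m invmx N).
have hE x : E x -> h (phi x *m N) = x.
  move=> Ex; rewrite /h mulmxK//; have [] := psiK (phi x); first by exists x.
  by move=> Ep /set_bij_injective; apply; rewrite inE; exact: EB.
pose s := (fun x => x *m N) @` (phi @` E).
have hs W : h @` (s `&` W) = E `&` phi @^-1` ((fun x => x *m N) @^-1` W).
  apply/seteqP; split => [_ [_ [[_ [x Ex <-] <-] Wx] <-]|x [Ex Wx]].
    by rewrite hE.
  exists (phi x *m N); last exact: hE.
  by split => //; exists (phi x) => //; exists x.
have hsE : h @` s = E by rewrite -[s]setIT hs preimage_setT setIT.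
have ms : measurable s by rewrite /s image_mulmx//; exact: measurable_mulmx_preimage.
rewrite EFinM -muleA -image_volume_mulmx// -/s -{1}hsE.
apply: (lipschitz_volume ms L0 LL').
  move=> _ _ [_ [x Ex <-] <-] [_ [y Ey <-] <-].
  by rewrite !hE// -mulmxBl; exact: HL.
move=> W mW; rewrite hs; apply: measurable_C1_preimage => //.
exact: measurable_mulmx_preimage.
Qed.

End image_volume.

(** * Comparison of volumes near regular points *)

Section local_volume.
Context {R : realType} (n : nat).
Local Notation V := 'rV[R]_n.
Local Notation lambda := (lebesgue_rV n : set 'rV[R]_n -> \bar R).
Variables (A B : set V) (phi : V -> V).
Hypotheses (oA : open A) (oB : open B) (bij : set_bij B A phi) (C1 : C1_on B phi).

Definition jac_volume (E : set V) : \bar R :=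
  (\int[lebesgue_rV n]_(w in E) (jac phi w)%:E)%E.

Lemma measurable_jac_in E : measurable E -> E `<=` B ->
  measurable_fun E (fun w => (jac phi w)%:E).
Proof.
move=> mE EB; apply/measurable_EFinP.
by apply: measurable_funS (measurable_jac oB C1) => //; exact: open_measurable_rV.
Qed.

Lemma jac_volume_le E (k : R) : measurable E -> E `<=` B -> 0 <= k ->
  (forall w, E w -> jac phi w <= k) -> (jac_volume E <= k%:E * lambda E)%E.
Proof.
move=> mE EB k0 Ek; rewrite -(integral_cst (lebesgue_rV n) mE).
apply: ge0_le_integral => //.
- by move=> w _; rewrite lee_fin jac_ge0.
- exact: measurable_jac_in.
Qed.

Lemma jac_volume_ge E (k : R) : measurable E -> E `<=` B -> 0 <= k ->
  (forall w, E w -> k <= jac phi w) -> (k%:E * lambda E <= jac_volume E)%E.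
Proof.
move=> mE EB k0 Ek; rewrite -(integral_cst (lebesgue_rV n) mE).
apply: ge0_le_integral => //.
exact: measurable_jac_in.
Qed.

(** With [N] the inverse derivative at x, [phi] followed by [N] differs from the identity by a map
    with Lipschitz constant eta. So it is Lipschitz with constant 1 + eta, and its inverse with
    constant 1 / (1 - eta). These give kappa^n; one more kappa pays for the variation of the
    Jacobian. *)
Lemma local_volume_regular x (kappa : R) : B x -> jac phi x != 0 -> 1 < kappa ->
  exists2 e : R, 0 < e & forall E, measurable E -> E `<=` B -> E `<=` ball x e ->
    (lambda (phi @` E) <= (kappa ^+ n.+1)%:E * jac_volume E)%E /\
    (jac_volume E <= (kappa ^+ n.+1)%:E * lambda (phi @` E))%E.
Proof.
move=> Bx; set a := jac phi x => a0' k1.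
have a0 : 0 < a by rewrite lt_def a0' jac_ge0.
have k0 : 0 < kappa by rewrite (lt_trans ltr01).
pose M := 'J phi x; pose N := invmx M.
have uM : M \in unitmx by rewrite unitmxE unitfE -normr_eq0.
have uN : N \in unitmx by rewrite unitmx_inv.
have detN : `|\det N| = a^-1 by rewrite det_inv normrV// unitfE -normr_eq0.
(* Small enough for both 1 + eta < kappa and 1 / (1 - eta) < kappa. *)
pose eta := (kappa - 1) / (2 * kappa).
have eta0 : 0 < eta by rewrite divr_gt0 ?subr_gt0// mulr_gt0.
have keta : kappa * eta = (kappa - 1) / 2 by rewrite /eta; field; rewrite gt_eqF.
have eta1 : eta < 1.
  by rewrite -(ltr_pM2l k0) keta mulr1 ltr_pdivrMr//; lra.
pose c := n%:R * `|N|.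
have c0 : 0 <= c by rewrite mulr_ge0.
have c1 : 0 < c + 1 by rewrite ltr_wpDl.
have [|e1 [e10 _ He1]] := C1_strict_differentiable (delta := eta / (c + 1)) oB C1 Bx.
  by rewrite divr_gt0.
have cJ : jac phi w @[w --> x] --> a.
  by apply: (continuous_jac oB C1); rewrite inE.
have : \forall w \near x, a / kappa <= jac phi w /\ jac phi w <= kappa * a.
  near=> w; split; apply: ltW; near: w.
    by apply: (cvgr_gt _ cJ); rewrite ltr_pdivrMr// ltr_pMr.
  by apply: (cvgr_lt _ cJ); rewrite ltr_pMl.
move=> /nbhs_ballP[e2 /= e20 He2].
exists (Num.min e1 e2); first by rewrite lt_min e10.
move=> E mE EB Ee.
have appr y z : E y -> E z ->
    `|(phi y - phi z) *m N - (y - z)| <= eta * `|y - z|.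
  move=> Ey Ez; rewrite -[y - z](mulmxK uM) -/N -mulmxBl (le_trans (norm_mulmx_le _ _))//.
  have ball1 w : E w -> ball x e1 w.
    by move=> /Ee; apply: le_ball; rewrite ge_min lexx.
  rewrite mulmxK// -/c (le_trans (ler_wpM2l c0 (He1 y z (ball1 _ Ey) (ball1 _ Ez))))//.
  rewrite mulrA; apply: ler_wpM2r => //.
  by rewrite mulrCA ler_piMr ?(ltW eta0)// ler_pdivrMr// mul1r lerDl.
have Jw w : E w -> a / kappa <= jac phi w /\ jac phi w <= kappa * a.
  by move=> /Ee xw; apply: He2; apply: le_ball xw; rewrite ge_min lexx orbT.
have fin_pos (t : R) : 0 <= t -> (0 <= t%:E)%E by rewrite lee_fin.
split.
- have up : (a^-1%:E * lambda (phi @` E) <= (kappa ^+ n)%:E * lambda E)%E.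
    rewrite -detN; apply: (image_volume_upper oA oB bij C1 uN mE EB (L := 1 + eta)).
    + by rewrite addr_ge0// ltW.
    + by rewrite -(ltr_pM2l k0) mulrDr mulr1 keta; nra.
    + move=> y z Ey Ez; rewrite mulrDl mul1r -lerBlDl (le_trans _ (appr y z Ey Ez))//.
      by rewrite (le_trans _ (lerB_dist _ _)).
  have lo := jac_volume_ge mE EB (divr_ge0 (ltW a0) (ltW k0)) (fun w Ew => (Jw w Ew).1).
  apply: (@le_trans _ _ ((a * kappa ^+ n)%:E * lambda E)%E).
    rewrite EFinM -muleA -[leLHS]mul1e -(divff a0') EFinM -muleA.
    by apply: lee_wpmul2l => //; apply: fin_pos; rewrite ltW.
  have -> : a * kappa ^+ n = kappa ^+ n.+1 * (a / kappa).
    by rewrite exprS; field; rewrite gt_eqF.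
  by rewrite EFinM -muleA; apply: lee_wpmul2l => //; rewrite fin_pos// exprn_ge0// ltW.
- apply: (le_trans (jac_volume_le mE EB _ (fun w Ew => (Jw w Ew).2))).
    by rewrite mulr_ge0// ltW.
  have low : (lambda E <= (kappa ^+ n * `|\det N|)%:E * lambda (phi @` E))%E.
    apply: (image_volume_lower oA oB bij C1 uN mE EB (L := (1 - eta)^-1)).
    + by rewrite invr_ge0 subr_ge0 ltW.
    + have k2 : 1 < kappa - (kappa - 1) / 2.
        by lra.
      rewrite -[X in _ < X]invrK ltf_pV2 ?posrE ?invr_gt0 ?subr_gt0//.
      by rewrite -(ltr_pM2l k0) mulrBr mulr1 keta divff ?gt_eqF//.
    + move=> y z Ey Ez; rewrite mulrC ler_pdivlMr ?subr_gt0// mulrBr mulr1 lerBlDl.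
      rewrite -lerBlDr [leRHS]mulrC (le_trans (lerB_dist _ _))//.
      by rewrite distrC; exact: appr.
  apply: (@le_trans _ _ ((kappa * a)%:E * ((kappa ^+ n * `|\det N|)%:E * lambda (phi @` E)))%E).
    by apply: lee_wpmul2l => //; rewrite fin_pos// mulr_ge0// ltW.
  rewrite muleA -EFinM detN.
  have -> // : kappa * a * (kappa ^+ n / a) = kappa ^+ n.+1.
  by rewrite exprS; field; rewrite gt_eqF.
Unshelve. all: by end_near. Qed.

End local_volume.

(** * From local to global inequalities *)

Section local_to_global.
Context {R : realType} (n : nat).
Local Notation V := 'rV[R]_n.

(** A property of bare set functions: the volume of the image is known to be additive only for
    subsets of B, where the map is injective. *)
Definition sigma_additive_in (B : set V) (m : set V -> \bar R) :=
  forall F : nat -> set V, (forall j, measurable (F j)) ->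
    (forall j, F j `<=` B) -> trivIset setT F ->
    m (\bigcup_j F j) = (\sum_(j <oo) m (F j))%E.

(** Each point of B lies in a grid cell so small that the inequality holds for all measurable
    subsets of the cell in B. There are countably many such cells; as the property passes to
    subsets, they can be made disjoint and the inequalities summed. *)
Lemma local_to_global_le (B : set V) (m1 m2 : set V -> \bar R) :
  sigma_additive_in B m1 -> sigma_additive_in B m2 ->
  (m1 set0 <= m2 set0)%E ->
  (forall E, measurable E -> E `<=` B -> (0 <= m1 E)%E) ->
  (forall x, B x -> exists2 e : R, 0 < e & forall E, measurable E ->
     E `<=` B -> E `<=` ball x e -> (m1 E <= m2 E)%E) ->
  forall E, measurable E -> E `<=` B -> (m1 E <= m2 E)%E.
Proof.
move=> add1 add2 m00 m10 loc E mE EB.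
pose P (U : set V) := forall F, measurable F -> F `<=` B -> F `<=` U -> (m1 F <= m2 F)%E.
pose G j : set V := if pickle_inv j is Some q then
  (if `[< P (grid q) >] then grid q else set0) else set0.
have mG j : measurable (G j).
  rewrite /G; case: pickle_inv => [q|//]; case: asboolP => // _.
  exact: measurable_grid.
have PG j : P (G j).
  have P0 : P set0 by move=> F _ _; rewrite subset0 => ->.
  rewrite /G; case: pickle_inv => [q|//]; by case: asboolP.
have BG : B `<=` \bigcup_j G j.
  move=> x /[dup] Bx /loc[e e0 He].
  have [N Ne] := exists_grid_mesh e0.
  have [k xk] := grid_cover N x.
  exists (pickle (N, k)) => //; rewrite /G pickleK_inv.
  case: asboolP => // H; case: H => F mF FB Fk; apply: He => // y /Fk yk.
  by rewrite -ball_normE/= (le_lt_trans (grid_close xk yk))// Ne.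
have mS j : measurable (E `&` seqDU G j).
  apply: measurableI => //; apply: measurableD => //.
  by apply: bigsetU_measurable => k _; exact: mG.
have EG : E = \bigcup_j (E `&` seqDU G j).
  by rewrite -setI_bigcupr -seqDU_bigcup_eq; apply/esym/setIidl => x /EB/BG.
have tE : trivIset setT (fun j => E `&` seqDU G j).
  exact/trivIset_setIl/trivIset_seqDU.
have EjB j : E `&` seqDU G j `<=` B by move=> x [/EB].
rewrite EG add1// add2//; apply: lee_nneseries => [j _ _|j _]; first exact: m10.
by apply: (PG j) => // x [_ []].
Qed.

End local_to_global.

(** * Critical points and countable additivity *)

Section volume_of_images.
Context {R : realType} (n : nat).
Local Notation V := 'rV[R]_n.
Local Notation lambda := (lebesgue_rV n : set 'rV[R]_n -> \bar R).
Variables (A B : set V) (phi : V -> V).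
Hypotheses (oA : open A) (oB : open B) (bij : set_bij B A phi) (C1 : C1_on B phi).

(* The product of the singular derivative with the map N does not depend on the
   stretching factor t of N. *)
Lemma local_volume_singular x (eps : R) : B x -> jac phi x = 0 -> 0 < eps ->
  exists2 e : R, 0 < e & forall E, measurable E -> E `<=` B -> E `<=` ball x e ->
    (lambda (phi @` E) <= eps%:E * lambda E)%E.
Proof.
move=> Bx Jx eps0.
pose M := 'J phi x.
have rM : (\rank M < n)%N.
  rewrite ltn_neqAle rank_leq_row andbT; apply/negP => rn.
  have : M \in unitmx by rewrite -row_free_unit.
  by rewrite unitmxE unitfE -normr_eq0 -/(jac phi x) Jx eqxx.
pose U := row_ebase M.
have uU : U \in unitmx by exact: row_ebase_unit.
have detU0 : 0 < `|\det U| by rewrite normr_gt0 -unitfE -unitmxE.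
pose K : 'M[R]_n := col_ebase M *m pid_mx (\rank M).
have MKU : M = K *m U by rewrite mulmx_ebase.
(* After multiplication by [N] the linear part becomes [K], and the remainder is at most |y - z|
   because of the tolerance 1 / (c + 1). So this constant is free of the stretching factor. *)
pose L := 1 + n%:R * `|K|.
have L0 : 0 < L by rewrite ltr_wpDr ?mulr_ge0.
(* Chosen so that |det N| = t / |det U| equals (L + 1)^n / eps. *)
pose t := `|\det U| * (L + 1) ^+ n / eps.
have Ln0 : 0 < (L + 1) ^+ n by rewrite exprn_gt0// addr_gt0.
have t0 : 0 < t by rewrite divr_gt0// mulr_gt0.
(* The stretched coordinate is the first one that vanishes on the image of [K]. *)
pose d : 'rV[R]_n := \row_j (if j == Ordinal rM then t else 1).
have detd : \det (diag_mx d) = t.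
  rewrite det_diag (bigD1 (Ordinal rM))//= mxE eqxx big1 ?mulr1// => j /negPf jr.
  by rewrite mxE jr.
have ud : diag_mx d \in unitmx by rewrite unitmxE detd unitfE gt_eqF.
have pidd : pid_mx (\rank M) *m diag_mx d = pid_mx (\rank M) :> 'M[R]_n.
  apply/matrixP => i j; rewrite mul_mx_diag !mxE.
  case: eqP => [->|_]; last by rewrite mul0r.
  have [jr|_] := boolP (j < \rank M)%N; last by rewrite mul0r.
  by rewrite ifN ?mulr1// -val_eqE/= neq_ltn jr.
pose N := invmx U *m diag_mx d.
have uN : N \in unitmx by rewrite unitmx_mul unitmx_inv uU.
have MN : M *m N = K.
  by rewrite MKU /N mulmxA mulmxK// /K -mulmxA pidd.
pose c := n%:R * `|N|.
have c0 : 0 <= c by rewrite mulr_ge0.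
have c1 : 0 < c + 1 by rewrite ltr_wpDl.
have [|e [e0 _ He]] := C1_strict_differentiable (delta := (c + 1)^-1) oB C1 Bx.
  by rewrite invr_gt0.
exists e => // E mE EB Ee.
have : (`|\det N|%:E * lambda (phi @` E) <= ((L + 1) ^+ n)%:E * lambda E)%E.
  apply: (image_volume_upper oA oB bij C1 uN mE EB (L := L)); [exact: ltW|by rewrite ltrDl|].
  move=> y z Ey Ez.
  have -> : (phi y - phi z) *m N = (phi y - phi z - (y - z) *m M) *m N + (y - z) *m K.
    by rewrite [X in _ = X + _]mulmxBl -mulmxA MN subrK.
  rewrite (le_trans (ler_normD _ _))// mulrDl mul1r lerD ?norm_mulmx_le//.
  rewrite (le_trans (norm_mulmx_le _ _))// -/c.
  rewrite (le_trans (ler_wpM2l c0 (He y z (Ee _ Ey) (Ee _ Ez))))//.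
  by rewrite mulrA ler_piMl// ler_pdivrMr// mul1r lerDl.
have -> : `|\det N| = (L + 1) ^+ n / eps.
  rewrite /N det_mulmx detd det_inv normrM normfV (gtr0_norm t0) /t mulrA mulrA.
  by rewrite mulVf ?mul1r// gt_eqF.
move=> H; have eL : 0 < eps / (L + 1) ^+ n by rewrite divr_gt0.
have -> : eps%:E = ((eps / (L + 1) ^+ n)%:E * ((L + 1) ^+ n)%:E)%E.
  by rewrite -EFinM divfK// gt_eqF.
rewrite -muleA -[leLHS]mul1e.
have -> : 1%E = ((eps / (L + 1) ^+ n)%:E * ((L + 1) ^+ n / eps)%:E)%E.
  by rewrite -EFinM mulf_div [X in _ / X]mulrC divff// gt_eqF// mulr_gt0.
by rewrite -muleA; apply: lee_wpmul2l => //; rewrite lee_fin ltW.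
Qed.

Local Notation nu := (fun E => lambda (phi @` E)).

Lemma image_volume_additive : sigma_additive_in B nu.
Proof.
move=> F mF FB tF; rewrite /= image_bigcup measure_semi_bigcup//.
- by move=> j; apply: (measurable_C1_image oA oB bij C1).
- apply/trivIsetP => i j _ _ ij; rewrite -subset0 => _ [[x Fx <-] [y Fy]].
  move=> /(set_bij_injective bij); rewrite !inE => /(_ (FB _ _ Fy) (FB _ _ Fx)) yx.
  by move/trivIsetP : tF => /(_ i j I I ij); rewrite -subset0 => /(_ x); apply; split; rewrite // -yx.
- apply: bigcupT_measurable => j; exact: (measurable_C1_image oA oB bij C1).
Qed.

Lemma jac_volume_additive : sigma_additive_in B (jac_volume phi).
Proof.
move=> F mF FB tF; rewrite /jac_volume ge0_integral_bigcup//.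
- by apply: (measurable_jac_in oB C1); [exact: bigcupT_measurable|move=> x [j _ /FB]].
- by move=> x _; rewrite lee_fin jac_ge0.
Qed.

Lemma jac_volume_ge0 E : (0 <= jac_volume phi E)%E.
Proof. by apply: integral_ge0 => x _; rewrite lee_fin jac_ge0. Qed.

Lemma sigma_additive_inZ (D : set V) (m : set V -> \bar R) (k : R) : 0 <= k ->
  (forall E, (0 <= m E)%E) -> sigma_additive_in D m ->
  sigma_additive_in D (fun E => k%:E * m E)%E.
Proof. by move=> k0 m0 addm F mF FB tF; rewrite addm// nneseriesZl. Qed.

Lemma sigma_additive_in_sub (D D' : set V) (m : set V -> \bar R) : D `<=` D' ->
  sigma_additive_in D' m -> sigma_additive_in D m.
Proof.
move=> DD' addm F mF FD tF; apply: addm => // j.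
exact: subset_trans (FD j) DD'.
Qed.

End volume_of_images.

(** * The change of variables formula *)

Section density_transfer.
Local Open Scope ereal_scope.
Context d1 d2 (X : measurableType d1) (Y : measurableType d2) (R : realType).
Variables (mu : {measure set X -> \bar R}) (nu : {measure set Y -> \bar R}).
Variables (D : set X) (phi : X -> Y) (w : X -> R).
Hypotheses (mD : measurable D) (mphi : measurable_fun D phi)
  (mw : measurable_fun D (EFin \o w)) (w0 : forall x, D x -> (0 <= w x)%R).
Hypothesis nuE : forall E, measurable E ->
  nu E = \int[mu]_(x in D `&` phi @^-1` E) (w x)%:E.

Import HBNNSimple.

Let density_transfer_nnsfun (g : {nnsfun Y >-> R}) :
  \int[nu]_y (g y)%:E = \int[mu]_(x in D) ((g (phi x))%:E * (w x)%:E).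
Proof.
have mg r : measurable (g @^-1` [set r]) by exact: measurable_sfunP.
rewrite integralT_nnsfun sintegralE.
under [RHS]eq_integral => x _.
  rewrite fimfunE -fsumEFin//.
  rewrite ge0_mule_fsuml; last by move=> r; rewrite EFinM nnfun_muleindic_ge0.
  over.
rewrite ge0_integral_fsum//; last 2 first.
- move=> r; apply: emeasurable_funM => //.
  apply/measurable_EFinP; apply: measurable_funM => //.
  by apply: measurableT_comp => //; exact: measurable_indic.
- by move=> r x Dx; apply: mule_ge0; [rewrite EFinM nnfun_muleindic_ge0|rewrite lee_fin w0].
apply: eq_fsbigr => r /set_mem [y _ gyr].
rewrite nuE// -ge0_integralZl//.
- rewrite integral_mkcondr; apply: eq_integral => x _.
  rewrite patchE indicE; case: ifPn => xr.
    by rewrite /= (_ : (phi x \in g @^-1` [set r]) = true) ?mulr1//; apply: mem_set; exact: (set_mem xr).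
  rewrite (_ : (phi x \in g @^-1` [set r]) = false) ?mulr0 ?mul0e//.
  by apply/negbTE; move: xr; apply: contra => /set_mem H; apply: mem_set.
- exact: mphi (mg r).
- by apply: (measurable_funS mD _ mw) => x [].
- by move=> x [Dx _]; exact: w0.
- by rewrite lee_fin -gyr.
Qed.

(** The formula for sets passes to integrals through simple functions and monotone convergence. It
    serves twice in the change of variables: for [phi] with the Jacobian as weight, and for the
    identity with weight 1, to express the measure restricted to A as an integral over A. *)
Lemma ge0_integral_density_transfer (h : Y -> \bar R) :
  measurable_fun setT h -> (forall y, 0 <= h y) ->
  \int[nu]_y h y = \int[mu]_(x in D) (h (phi x) * (w x)%:E).
Proof.
move=> mh h0.
pose g := nnsfun_approx measurableT mh.
have gh y : (g n y)%:E @[n --> \oo] --> h y by exact: cvg_nnsfun_approx.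
have ndg y : {homo (fun n => g n y) : m n / (m <= n)%N >-> (m <= n)%R}.
  by move=> m n mn; exact/lefP/nd_nnsfun_approx.
transitivity (limn (fun n => \int[nu]_y (g n y)%:E)).
  rewrite -monotone_convergence//.
  - by apply: eq_integral => y _; apply/esym/cvg_lim.
  - by move=> n; exact/measurable_EFinP.
  - by move=> n y _; rewrite lee_fin.
  - by move=> y _ m n mn; rewrite lee_fin; exact: ndg.
under eq_fun do rewrite density_transfer_nnsfun.
rewrite -monotone_convergence//.
- apply: eq_integral => x /set_mem Dx; apply/cvg_lim => //.
  exact: cvgeZr.
- move=> n; apply: emeasurable_funM => //; apply/measurable_EFinP.
  exact: measurableT_comp.
- by move=> n x Dx; rewrite mule_ge0 ?lee_fin ?w0.
- by move=> x Dx m n mn; apply: lee_wpmul2r; rewrite ?lee_fin ?w0//; exact: ndg.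
Qed.

End density_transfer.

Section change_of_variables.
Context {R : realType}.

Lemma lee_mul_expr_gt1 (a b : \bar R) m : (0 <= b)%E ->
  (forall k : R, 1 < k -> (a <= (k ^+ m.+1)%:E * b)%E) -> (a <= b)%E.
Proof.
case: b => [b| |//] b0 H; last by rewrite leey.
rewrite lee_fin in b0.
have b1 : 0 < b + 1 by rewrite ltr_wpDl.
apply/lee_addgt0Pr => e e0.
have eb : 0 < e / (b + 1) by rewrite divr_gt0.
(* The root is taken so that k^(m+1) b = b + e b / (b + 1), which is at most b + e. *)
pose k := (1 + e / (b + 1)) `^ m.+1%:R^-1.
have kE : k ^+ m.+1 = 1 + e / (b + 1).
  by rewrite -powR_mulrn ?powR_ge0// -powRrM mulVf// powRr1// addr_ge0// ltW.
have k1 : 1 < k.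
  rewrite ltNge; apply/negP => kle; suff : k ^+ m.+1 <= 1 by rewrite kE; lra.
  by rewrite exprn_ile1// powR_ge0.
rewrite (le_trans (H k k1))// -EFinM -EFinD lee_fin kE mulrDl mul1r lerD2l.
by rewrite mulrAC ler_pdivrMr// ler_pM2l// lerDl.
Qed.

Context (n : nat).
Local Notation V := 'rV[R]_n.
Local Notation lambda := (lebesgue_rV n : set 'rV[R]_n -> \bar R).
Variables (A B : set V) (phi : V -> V).
Hypotheses (oA : open A) (oB : open B) (bij : set_bij B A phi) (C1 : C1_on B phi).

Let mB : measurable B. Proof. exact: open_measurable_rV. Qed.

Let mimage E : measurable E -> E `<=` B -> measurable (phi @` E).
Proof. exact: (measurable_C1_image oA oB bij C1). Qed.

(** A Sard-type statement. The local bounds hold with any factor d > 0, and d times the volume of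
    the set tends to 0 only if that volume is finite; hence the exhaustion by balls. *)
Lemma image_volume_singular E : measurable E -> E `<=` B ->
  (forall x, E x -> jac phi x = 0) -> lambda (phi @` E) = 0.
Proof.
move=> mE EB E0.
have step F : measurable F -> F `<=` E -> (lambda F < +oo)%E -> (lambda (phi @` F) <= 0)%E.
  move=> mF FE Foo; apply/lee_addgt0Pr => e e0; rewrite add0e.
  have [f0 Ffin] : 0 <= fine (lambda F) /\ lambda F \is a fin_num.
    by split; [exact/fine_ge0|rewrite ge0_fin_numE].
  pose d := e / (fine (lambda F) + 1).
  have f1 : 0 < fine (lambda F) + 1 by rewrite ltr_wpDl.
  have d0 : 0 < d by rewrite divr_gt0.
  have : (lambda (phi @` F) <= d%:E * lambda F)%E.
    apply: (@local_to_global_le _ _ E (fun F => lambda (phi @` F)) (fun F => d%:E * lambda F)%E) => //.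
    - apply: sigma_additive_in_sub EB _.
      exact: (image_volume_additive oA oB bij C1).
    - move=> G mG GE tG; rewrite /= measure_semi_bigcup//; first by rewrite nneseriesZl.
      exact: bigcupT_measurable.
    - by rewrite image_set0 !measure0 mule0.
    - move=> x Ex; have [r r0 Hr] := local_volume_singular oA oB bij C1 (EB _ Ex) (E0 _ Ex) d0.
      by exists r => // G mG GE Gr; apply: Hr => //; exact: subset_trans EB.
  move=> /le_trans; apply; rewrite -(fineK Ffin) -EFinM lee_fin /d mulrAC.
  by rewrite ler_pdivrMr// ler_pM2l// lerDl.
apply/eqP; rewrite -measure_le0.
have EE : E = \bigcup_k (E `&` ball (0 : V) k.+1%:R).
  rewrite -setI_bigcupr; apply/esym/setIidPl => x _.
  exists (Num.truncn `|x|) => //.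
  by rewrite -ball_normE/= sub0r normrN truncnS_gt.
have mEk k : measurable (E `&` ball (0 : V) k.+1%:R).
  by apply: measurableI => //; apply: open_measurable_rV; exact: ball_open.
rewrite EE image_bigcup; apply: nondecreasing_mu_le => [k|k l kl|k].
- by apply: mimage => // x [/EB].
- apply/subsetPset; apply: image_subset; apply: setIS.
  by apply: le_ball; rewrite ler_nat.
- apply: step => //; apply: le_lt_trans (@lebesgue_rV_ball_lty R n k.+1%:R _) => //.
  by apply: le_measure; rewrite ?inE//; apply: open_measurable_rV; exact: ball_open.
Qed.

(** The two-sided local comparison is available only where the Jacobian is nonzero. The critical
    part of E contributes 0 to both sides; on the rest the factor k tends to 1. *)
Theorem image_volume E : measurable E -> E `<=` B ->
  lambda (phi @` E) = jac_volume phi E.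
Proof.
move=> mE EB.
have mJ : measurable_fun E (jac phi : V -> measurableTypeR R).
  exact: measurable_funS (measurable_jac oB C1).
pose E0 := E `&` (jac phi @^-1` [set 0]); pose E1 := E `&` (jac phi @^-1` (~` [set 0])).
have mE0 : measurable E0 by apply: mJ => //; exact: measurable_set1.
have mE1 : measurable E1 by apply: mJ => //; apply: measurableC; exact: measurable_set1.
have E01 : E = E0 `|` E1 by rewrite -setIUr -preimage_setU setUv preimage_setT setIT.
have E0B : E0 `<=` B by move=> x [/EB].
have E1B : E1 `<=` B by move=> x [/EB].
have dis : [disjoint E0 & E1].
  by apply/disj_setPS => x [[_ J0] [_ J1]]; exact: J1.
have -> : jac_volume phi E = jac_volume phi E1.
  rewrite [in LHS]E01 /jac_volume ge0_integral_setU//.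
  - rewrite [X in (X + _)%E](_ : _ = 0%E) ?add0e//.
    rewrite -[LHS]/(jac_volume phi E0).
    apply/eqP; rewrite eq_le jac_volume_ge0 andbT -[leRHS](mul0e (lambda E0)).
    by apply: (jac_volume_le oB C1) => // w [_ /= ->].
  - by rewrite -E01; exact: (measurable_jac_in oB C1).
  - by move=> x _; rewrite lee_fin jac_ge0.
have -> : lambda (phi @` E) = lambda (phi @` E1).
  rewrite [in LHS]E01 image_setU measureU; last 3 first.
  - exact: mimage.
  - exact: mimage.
  - rewrite -subset0 => _ [[x [Ex J0] <-] [y [Ey J1]]].
    move=> /(set_bij_injective bij); rewrite !inE => /(_ (EB _ Ey) (EB _ Ex)) yx.
    by apply: J1; rewrite yx.
  rewrite [X in (X + _)%E]image_volume_singular ?add0e//.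
  by move=> x [].
have add_nu : sigma_additive_in E1 (fun F => lambda (phi @` F)).
  by apply: sigma_additive_in_sub E1B _; exact: (image_volume_additive oA oB bij C1).
have add_mu : sigma_additive_in E1 (jac_volume phi).
  by apply: sigma_additive_in_sub E1B _; exact: (jac_volume_additive oB C1).
have J1 x : E1 x -> jac phi x != 0 by move=> [_ /eqP].
have nu0 : lambda (phi @` set0) = 0 by rewrite image_set0 measure0.
have mu0 : jac_volume phi set0 = 0 by rewrite /jac_volume integral_set0.
have k0 (k : R) m : 1 < k -> 0 <= k ^+ m by move=> k1; rewrite exprn_ge0// ltW// (lt_trans ltr01).
apply/eqP; rewrite eq_le; apply/andP; split.
- apply: (@lee_mul_expr_gt1 _ _ n); first exact: jac_volume_ge0.
  move=> k k1.
  apply: (@local_to_global_le _ _ E1 (fun F => lambda (phi @` F))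
      (fun F => (k ^+ n.+1)%:E * jac_volume phi F)%E) => //.
  + by apply: sigma_additive_inZ => //; [exact: k0|move=> F; exact: jac_volume_ge0].
  + by rewrite nu0 mu0 mule0.
  + move=> x Ex; have [r r0 Hr] := local_volume_regular oA oB bij C1 (E1B _ Ex) (J1 _ Ex) k1.
    by exists r => // G mG GE Gr; have [] := Hr G mG (subset_trans GE E1B) Gr.
- apply: (@lee_mul_expr_gt1 _ _ n) => // k k1.
  apply: (@local_to_global_le _ _ E1 (jac_volume phi)
      (fun F => (k ^+ n.+1)%:E * lambda (phi @` F))%E) => //.
  + by apply: (@sigma_additive_inZ _ _ _ (fun F => lambda (phi @` F))) => //; exact: k0.
  + by rewrite nu0 mu0 mule0.
  + by move=> F _ _; exact: jac_volume_ge0.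
  + move=> x Ex; have [r r0 Hr] := local_volume_regular oA oB bij C1 (E1B _ Ex) (J1 _ Ex) k1.
    by exists r => // G mG GE Gr; have [] := Hr G mG (subset_trans GE E1B) Gr.
Qed.

Theorem ge0_change_of_variables (h : V -> \bar R) :
  measurable_fun setT h -> (forall y, 0 <= h y)%E ->
  (\int[lebesgue_rV n]_(y in A) h y =
   \int[lebesgue_rV n]_(x in B) (h (phi x) * (jac phi x)%:E))%E.
Proof.
move=> mh h0.
have mA : measurable A by exact: open_measurable_rV.
have mphi := continuous_in_measurable_fun_rV oB (C1_on_continuous C1).
rewrite -(@ge0_integral_density_transfer _ _ _ _ _ (lebesgue_rV n)
  (mrestr (lebesgue_rV n) mA) B phi (jac phi))//.
- rewrite (@ge0_integral_density_transfer _ _ _ _ _ (lebesgue_rV n)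
    (mrestr (lebesgue_rV n) mA) A id (fun=> 1))//.
  + by apply: eq_integral => y _; rewrite mule1.
  + exact: measurable_cst.
  + move=> E mE; transitivity (\int[lebesgue_rV n]_(x in A `&` E) (cst 1%E x))%E => //.
    rewrite integral_cst ?mul1e; last exact: measurableI.
    by rewrite /= /mrestr setIC.
- exact: (measurable_jac_in oB C1).
- by move=> x _; exact: jac_ge0.
- move=> E mE; rewrite -[RHS]/(jac_volume phi _) -image_volume.
  + rewrite /= /mrestr; congr (lebesgue_rV n _).
    rewrite -(set_bij_image bij); apply/seteqP; split.
      by move=> y [Ey [x Bx xy]]; exists x => //; split => //=; rewrite xy.
    by move=> _ [x [Bx Ex] <-]; split => //; exists x.
  + exact: mphi.
  + by move=> x [].
Qed.

End change_of_variables.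

(** * Truncated geometric sums *)

Section truncated_geometric_sums.
Context {R : realType}.
Implicit Types p alpha q s : R.

(** A partial sum bounding the p-th power of the metric, up to the constant and the powers of tau_0
    and |f|_r, with q = sqrt omega and s = eps / sqrt tau_0. *)
Definition trunc_sum p alpha q s n : R :=
  \sum_(k < n) (q ^+ k) `^ (p * alpha) * (Num.min 1 (s / q ^+ k)) `^ p.

(** Dropping the coarsest scale replaces s by s / q; this self-similarity drives the inductions
    below. *)
Lemma trunc_sumS p alpha q s n : 0 < q -> trunc_sum p alpha q s n.+1 =
  (Num.min 1 s) `^ p + q `^ (p * alpha) * trunc_sum p alpha q (s / q) n.
Proof.
move=> q0; rewrite /trunc_sum big_ord_recl expr0 powR1 mul1r invr1 mulr1.
congr (_ + _); rewrite mulr_sumr; apply: eq_bigr => k _ /=.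
rewrite /bump/= add1n exprS powRM ?exprn_ge0 ?(ltW q0)// -mulrA.
by congr (_ * (_ * (Num.min _ _) `^ _)); rewrite invfM mulrA.
Qed.

Lemma powR_lt1 q x : 0 < q -> q < 1 -> 0 < x -> q `^ x < 1.
Proof.
move=> q0 q1 x0; have := @gt0_ltr_powR R x x0 q 1.
by rewrite powR1; apply => //; rewrite nnegrE ltW.
Qed.

Lemma powR_le1 q x : 0 <= q -> q <= 1 -> 0 <= x -> q `^ x <= 1.
Proof.
move=> q0 q1 x0; have := @ge0_ler_powR R x x0 q 1.
by rewrite powR1; apply; rewrite ?nnegrE.
Qed.

(** Weighted AM-GM for q and 1 gives q^beta <= beta q + (1 - beta). This turns the sums 1 / (1 -
    q^(p beta)) of geometric series into the factors of [Delta]. *)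
Lemma onem_powR_ge q beta p : 0 < q -> q < 1 -> 0 < beta -> beta <= 1 -> 1 <= p ->
  beta * (1 - q) <= 1 - q `^ (p * beta).
Proof.
move=> q0 q1 b0 b1 p1.
have : q `^ (p * beta) <= q `^ beta.
  by apply: ger_powR; [rewrite q0 ltW|rewrite ler_peMl// ltW].
suff : q `^ beta <= 1 - beta * (1 - q) by lra.
have [->|b1'] := eqVneq beta 1.
  by rewrite powRr1 ?(ltW q0)// mul1r opprB addrC subrK.
have bl1 : beta < 1 by rewrite lt_neqAle b1'.
have := @conjugate_powR R (q `^ beta) 1 beta^-1 (1 - beta)^-1.
rewrite mulr1 !invrK powR1 mul1r -powRrM mulfV ?gt_eqF// powRr1 ?(ltW q0)//.
move=> H; have : q `^ beta <= q * beta + (1 - beta).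
  by apply: H; rewrite ?powR_ge0 ?invr_gt0 ?subr_gt0// addrC subrK.
by lra.
Qed.

(** Bounding each minimum by 1 leaves a geometric series. It ends the inductions below once s / q >=
    1. *)
Lemma trunc_sum_le p alpha q s n : 0 < q -> q < 1 -> 0 < p -> 0 < alpha ->
  0 <= s -> trunc_sum p alpha q s n <= (1 - q `^ (p * alpha))^-1.
Proof.
move=> q0 q1 p0 a0; set a := q `^ _.
have a1 : a < 1 by rewrite powR_lt1// mulr_gt0.
have a00 : 0 <= a by rewrite powR_ge0.
elim: n s => [|n IH] s s0; first by rewrite /trunc_sum big_ord0 invr_ge0 subr_ge0 ltW.
rewrite trunc_sumS// -/a.
have -> : (1 - a)^-1 = 1 + a * (1 - a)^-1 by field; rewrite subr_eq0 gt_eqF.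
rewrite lerD//; last by rewrite ler_wpM2l// IH// divr_ge0// ltW.
by rewrite powR_le1 ?le_min ?ler01 ?s0// ?ge_min ?lexx// ltW.
Qed.

Lemma min1_powR_le s p : 0 <= s -> 0 <= p -> (Num.min 1 s) `^ p <= s `^ p.
Proof.
move=> s0 p0; apply: ge0_ler_powR; rewrite ?nnegrE ?le_min ?ler01 ?s0//.
by rewrite ge_min lexx orbT.
Qed.

(** The terms grow geometrically until q^k is about s, where they have size s^(p alpha), and then
    decay geometrically. Read away from this peak, the two ratios are [c] and [a]. *)
Lemma trunc_sum_subcritical p alpha q s n : 0 < q -> q < 1 -> 1 <= p ->
  0 < alpha -> alpha < 1 -> 0 < s -> s < 1 ->
  trunc_sum p alpha q s n <=
    s `^ (p * alpha) * ((1 - q) * (alpha - alpha ^+ 2))^-1.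
Proof.
move=> q0 q1 p1 a0 a1 s0 s1.
have p0 : 0 < p by lra.
pose a := q `^ (p * alpha); pose c := q `^ (p * (1 - alpha)).
have al1 : a < 1 by rewrite powR_lt1// mulr_gt0.
have cl1 : c < 1 by rewrite powR_lt1// mulr_gt0// subr_gt0.
have ag0 : 0 < a by rewrite powR_gt0.
have cg0 : 0 < c by rewrite powR_gt0.
have acE : a * c = q `^ p.
  by rewrite /a /c -powRD ?(gt_eqF q0) ?implybT// -mulrDr subrKC mulr1.
(* X t^(p alpha) - Y t^p is stable under the recursion [trunc_sumS]. *)
pose X := (1 - a)^-1 + (1 - c)^-1; pose Y := c / (1 - c).
have Y0 : 0 <= Y by rewrite divr_ge0 ?subr_ge0 ?ltW.
have a10 : 0 < (1 - a)^-1 by rewrite invr_gt0 subr_gt0.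
have c10 : 0 < (1 - c)^-1 by rewrite invr_gt0 subr_gt0.
have YE : Y = (1 - c)^-1 - 1 by rewrite /Y; field; rewrite subr_eq0 gt_eqF.
have Yc : Y * c = Y - c.
  by rewrite /Y; field; rewrite subr_eq0 gt_eqF.
have aE : a * (1 - a)^-1 = (1 - a)^-1 - 1 by field; rewrite subr_eq0 gt_eqF.
have le_pow (t : R) : 0 < t -> t <= 1 -> t `^ p <= t `^ (p * alpha).
  by move=> t0 t1; apply: ger_powR; [rewrite t0|rewrite ler_piMr ?ltW].
have key (t : R) m : 0 < t -> t < 1 ->
    trunc_sum p alpha q t m <= X * t `^ (p * alpha) - Y * t `^ p.
  elim: m t => [|m IH] t t0 t1.
    rewrite /trunc_sum big_ord0 subr_ge0 ler_pM ?powR_ge0 ?le_pow ?(ltW t1)//.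
    by rewrite YE /X; lra.
  rewrite trunc_sumS// -/a (min_idPr (ltW t1)).
  have [tq|tq] := ltP t q.
    have u0 : 0 < t / q by rewrite divr_gt0.
    have := IH _ u0; rewrite ltr_pdivrMr// mul1r => /(_ tq) IHu.
    have tE x : t `^ x = (t / q) `^ x * q `^ x by rewrite -powRM ?ltW// divfK ?gt_eqF.
    rewrite (tE p) (tE (p * alpha)) -/a -acE.
    rewrite [leRHS](_ : _ = (t / q) `^ p * (a * c) +
        a * (X * (t / q) `^ (p * alpha) - Y * (t / q) `^ p)); last first.
      rewrite [Y * (_ * _)](_ : _ = (t / q) `^ p * a * (Y * c)); last by ring.
      by rewrite Yc; ring.
    by rewrite lerD2l; apply: ler_wpM2l => //; exact: ltW.
  have u0 : 0 <= t / q by rewrite divr_ge0// ltW.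
  have IHu := ler_wpM2l (ltW ag0) (trunc_sum_le m q0 q1 p0 a0 u0).
  rewrite (le_trans (lerD (lexx _) IHu))// aE.
  have at_ : a <= t `^ (p * alpha).
    by apply: ge0_ler_powR; rewrite ?nnegrE ?mulr_ge0// ?ltW.
  have h1 := ler_wpM2r (ltW a10) at_.
  have h2 := ler_wpM2r (ltW c10) (le_pow t t0 (ltW t1)).
  by move: h1; rewrite aE YE /X; lra.
rewrite (le_trans (key s n s0 s1))//.
rewrite (@le_trans _ _ (X * s `^ (p * alpha)))//.
  by rewrite gerBl mulr_ge0// powR_ge0.
rewrite mulrC ler_wpM2l ?powR_ge0//.
have q10 : 0 < 1 - q by rewrite subr_gt0.
have al10 : 0 < 1 - alpha by rewrite subr_gt0.
(* Since 1/alpha + 1/(1 - alpha) = 1/(alpha - alpha^2), the two geometric series together give the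
   denominator of [Delta]. *)
rewrite (_ : (_ * _)^-1 = (alpha * (1 - q))^-1 + ((1 - alpha) * (1 - q))^-1).
  rewrite lerD// lef_pV2 ?posrE ?subr_gt0 ?mulr_gt0//.
    by rewrite onem_powR_ge// ltW.
  by rewrite onem_powR_ge//; lra.
have -> : alpha - alpha ^+ 2 = alpha * (1 - alpha) by ring.
by field; rewrite !gt_eqF.
Qed.

Lemma ln_inv_ge q : 0 < q -> 1 - q <= ln q^-1.
Proof.
move=> q0; rewrite lnV ?posrE// lerNr opprB.
by have := @le_ln1Dx R (q - 1); rewrite subrKC; apply; lra.
Qed.

(** The terms with q^k >= s all equal s^p. There are about ln(1/s) / ln(1/q) of them, and ln(1/q) >=
    1 - q. The remaining geometric tail is absorbed by the added 1 and the factor 2. *)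
Lemma trunc_sum_critical p q s n : 0 < q -> q < 1 -> 1 <= p -> 0 < s -> s < 1 ->
  trunc_sum p 1 q s n <= s `^ p * (2 * (ln s^-1 + 1) / (1 - q)).
Proof.
move=> q0 q1 p1 s0 s1.
have p0 : 0 < p by lra.
have q10 : 0 < 1 - q by rewrite subr_gt0.
pose a := q `^ p.
have al1 : a < 1 by rewrite powR_lt1.
have ag0 : 0 < a by rewrite powR_gt0.
pose W := (1 - q)^-1; pose Z := 1 + (1 - a)^-1.
have W0 : 0 < W by rewrite invr_gt0.
have a10 : 0 < (1 - a)^-1 by rewrite invr_gt0 subr_gt0.
have lnV0 (t : R) : 0 < t -> t < 1 -> 0 <= ln t^-1.
  by move=> t0 t1; rewrite ln_ge0// invf_ge1// ltW.
have key (t : R) m : 0 < t -> t < 1 ->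
    trunc_sum p 1 q t m <= t `^ p * (Z + W * ln t^-1).
  elim: m t => [|m IH] t t0 t1.
    rewrite /trunc_sum big_ord0 mulr_ge0 ?powR_ge0// /Z.
    have := mulr_ge0 (ltW W0) (lnV0 t t0 t1); lra.
  rewrite trunc_sumS// mulr1 -/a (min_idPr (ltW t1)).
  have tE : t `^ p = (t / q) `^ p * a.
    by rewrite -powRM ?divr_ge0 ?(ltW t0) ?(ltW q0)// divfK ?gt_eqF.
  have [tq|tq] := ltP t q.
    have u0 : 0 < t / q by rewrite divr_gt0.
    have := IH _ u0; rewrite ltr_pdivrMr// mul1r => /(_ tq) IHu.
    rewrite (le_trans (lerD (lexx _) (ler_wpM2l (ltW ag0) IHu)))//.
    rewrite mulrA [a * _]mulrC -tE -{1}[t `^ p]mulr1 -mulrDr ler_wpM2l ?powR_ge0//.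
    have -> : ln (t / q)^-1 = ln t^-1 - ln q^-1.
      by rewrite !lnV ?posrE// ln_div ?posrE//; ring.
    have := ler_wpM2l (ltW W0) (ln_inv_ge q0).
    by rewrite {1}/W mulVf ?gt_eqF//; lra.
  have u0 : 0 <= t / q by rewrite divr_ge0// ltW.
  have := trunc_sum_le m q0 q1 p0 ltr01 u0; rewrite mulr1 -/a => IHu.
  rewrite (le_trans (lerD (lexx _) (ler_wpM2l (ltW ag0) IHu)))//.
  have at_ : a <= t `^ p by apply: ge0_ler_powR; rewrite ?nnegrE// ?ltW.
  have h1 := ler_wpM2r (ltW a10) at_.
  have h2 := mulr_ge0 (powR_ge0 t p) (mulr_ge0 (ltW W0) (lnV0 t t0 t1)).
  by rewrite /Z; lra.
rewrite (le_trans (key s n s0 s1))// ler_wpM2l ?powR_ge0//.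
have aq : (1 - a)^-1 <= W.
  rewrite lef_pV2 ?posrE ?subr_gt0//.
  by have := onem_powR_ge q0 q1 ltr01 (lexx 1) p1; rewrite mul1r mulr1.
have W1 : 1 <= W by rewrite invf_ge1//; lra.
have := mulr_ge0 (ltW W0) (lnV0 s s0 s1).
by rewrite /Z -/W; lra.
Qed.

(** Here the minimum may be replaced by s / q^k at every scale: the resulting geometric series of
    ratio q^(p (alpha - 1)) converges. *)
Lemma trunc_sum_supercritical p alpha q s n : 0 < q -> q < 1 -> 1 <= p ->
  1 < alpha -> 0 < s ->
  trunc_sum p alpha q s n <= s `^ p * ((1 - q) * Num.min (alpha - 1) 1)^-1.
Proof.
move=> q0 q1 p1 a1 s0.
have p0 : 0 < p by lra.
have q10 : 0 < 1 - q by rewrite subr_gt0.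
have a10 : 0 < alpha - 1 by rewrite subr_gt0.
pose b := q `^ (p * (alpha - 1)).
have bl1 : b < 1 by rewrite powR_lt1// mulr_gt0.
have bE : q `^ (p * alpha) = q `^ p * b.
  by rewrite /b -powRD ?(gt_eqF q0) ?implybT//; congr powR; ring.
have b10 : 0 < (1 - b)^-1 by rewrite invr_gt0 subr_gt0.
have key (t : R) m : 0 < t -> trunc_sum p alpha q t m <= t `^ p * (1 - b)^-1.
  elim: m t => [|m IH] t t0.
    by rewrite /trunc_sum big_ord0 mulr_ge0 ?powR_ge0 ?ltW.
  have u0 : 0 < t / q by rewrite divr_gt0.
  rewrite trunc_sumS//.
  rewrite (le_trans (lerD (min1_powR_le (ltW t0) (ltW p0)) (ler_wpM2l (powR_ge0 _ _) (IH _ u0))))//.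
  have tE : t `^ p = (t / q) `^ p * q `^ p.
    by rewrite -powRM ?divr_ge0 ?(ltW t0) ?(ltW q0)// divfK ?gt_eqF.
  rewrite bE [leLHS](_ : _ = t `^ p * (1 + b * (1 - b)^-1)); last by rewrite tE; ring.
  rewrite ler_wpM2l ?powR_ge0//.
  by rewrite [leLHS](_ : _ = (1 - b)^-1)//; field; rewrite subr_eq0 gt_eqF.
rewrite (le_trans (key s n s0))// ler_wpM2l ?powR_ge0//.
rewrite lef_pV2 ?posrE ?subr_gt0 ?mulr_gt0// ?lt_min ?a10 ?ltr01//.
have [am1|am1] := leP (alpha - 1) 1.
  by rewrite mulrC onem_powR_ge.
rewrite mulr1.
have := onem_powR_ge q0 q1 ltr01 (lexx 1) p1; rewrite mul1r mulr1 => /le_trans; apply.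
by rewrite lerD2l lerN2; apply: ger_powR; [rewrite q0 ltW|rewrite ler_peMr// ltW].
Qed.

(** The three bounds contain 1 / (1 - q) to the first power and a factor at most 2. Both are at
    least 1, so for p >= 1 they are below their p-th powers and fit under the exponent p. *)
Lemma trunc_sum_Delta_gt0 p alpha q s n : 0 < q -> q < 1 -> 1 <= p -> 0 < alpha ->
  0 < s -> s < 1 ->
  trunc_sum p alpha q s n <= (2 * (Delta alpha p s / (1 - q))) `^ p.
Proof.
move=> q0 q1 p1 a0 s0 s1.
have p0 : 0 < p by lra.
have pn0 : p != 0 by rewrite gt_eqF.
have q10 : 0 < 1 - q by rewrite subr_gt0.
have powRV x : 0 <= x -> (x `^ p^-1) `^ p = x.
  by move=> x0; rewrite -powRrM mulVf// powRr1.
have powR_inv (x : R) : 0 < x -> (x^-1) `^ p = (x `^ p)^-1.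
  by move=> x0; rewrite -powR_inv1 ?ltW// powRAC powR_inv1 ?powR_ge0.
have two : 2 <= 2 `^ p :> R by rewrite -[leLHS]powRr1// ler_powR// ler1n.
have Q : (1 - q)^-1 <= ((1 - q)^-1) `^ p.
  by apply: le1r_powR => //; rewrite invf_ge1//; lra.
have Q0 : 0 < (1 - q)^-1 by rewrite invr_gt0.
have enough (T y : R) : 0 <= y -> T <= 2 * (y `^ p * (1 - q)^-1) ->
    T <= (2 * (y / (1 - q))) `^ p.
  move=> y0 /le_trans; apply; rewrite !powRM ?divr_ge0 ?(ltW q10)// ?(ltW Q0)//.
  rewrite ler_pM// ?mulr_ge0 ?powR_ge0 ?(ltW Q0)//.
  by rewrite ler_wpM2l ?powR_ge0.
have double (x : R) : 0 <= x -> x <= 2 * x by lra.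
rewrite /Delta gt_eqF//; case: ltgtP => [al1|al1|->].
- have aa0 : 0 < alpha - alpha ^+ 2.
    by have -> : alpha - alpha ^+ 2 = alpha * (1 - alpha); [ring|rewrite mulr_gt0 ?subr_gt0].
  apply: enough; first by rewrite divr_ge0 ?powR_ge0.
  rewrite (le_trans (trunc_sum_subcritical n q0 q1 p1 a0 al1 s0 s1))//.
  rewrite powRM ?invr_ge0 ?powR_ge0// powR_inv ?powR_gt0// powRV ?(ltW aa0)//.
  rewrite -powRrM [alpha * p]mulrC invfM [_ * (alpha - _)^-1]mulrC -mulrA.
  by apply: double; rewrite !mulr_ge0 ?powR_ge0 ?invr_ge0 ?(ltW aa0) ?(ltW q10).
- have a10 : 0 < alpha - 1 by rewrite subr_gt0.
  have m0 : 0 < Num.min ((alpha - 1) `^ p^-1) 1 by rewrite lt_min powR_gt0// ltr01.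
  have minE : (Num.min ((alpha - 1) `^ p^-1) 1) `^ p = Num.min (alpha - 1) 1.
    have pV0 : 0 < p^-1 by rewrite invr_gt0.
    have [am1|am1] := leP (alpha - 1) 1.
      by rewrite (min_idPl _) ?powRV ?(ltW a10)// powR_le1 ?(ltW a10)// ltW.
    rewrite (min_idPr _) ?powR1//.
    have := @ge0_ler_powR R p^-1 (ltW pV0) 1 (alpha - 1).
    by rewrite powR1; apply; rewrite ?nnegrE// ltW.
  apply: enough; first by rewrite divr_ge0 ?ltW.
  rewrite (le_trans (trunc_sum_supercritical n q0 q1 p1 al1 s0))//.
  rewrite powRM ?invr_ge0 ?(ltW s0) ?(ltW m0)// powR_inv// minE.
  rewrite invfM [_ * (Num.min _ _)^-1]mulrC -mulrA.
  apply: double; rewrite !mulr_ge0 ?powR_ge0 ?invr_ge0 ?(ltW q10)//.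
  by rewrite le_min (ltW a10) ler01.
- have L0 : 0 <= ln s^-1 + 1 by rewrite addr_ge0// ln_ge0// invf_ge1// ltW.
  apply: enough; first by rewrite mulr_ge0 ?powR_ge0 ?ltW.
  rewrite (le_trans (trunc_sum_critical n q0 q1 p1 s0 s1))//.
  rewrite powRM ?powR_ge0 ?(ltW s0)// powRV//.
  by rewrite [leLHS](_ : _ = 2 * (s `^ p * (ln s^-1 + 1) * (1 - q)^-1)) //; ring.
Qed.

End truncated_geometric_sums.

(** * Gaussians *)

Section gaussians.
Context {R : realType}.

(** Read off from the total mass of the normal density of variance t / 2. *)
Lemma integral_expR_sqr (t : R) : 0 < t ->
  (\int[lebesgue_measure]_(x in [set: measurableTypeR R]) (expR (- (x ^+ 2 / t)))%:E)%E =
  (Num.sqrt (pi * t))%:E.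
Proof.
move=> t0; pose s := Num.sqrt (t / 2).
have t20 : 0 <= t / 2 by rewrite divr_ge0// ltW.
have s0 : s != 0 by rewrite gt_eqF// sqrtr_gt0 divr_gt0.
have sE : s ^+ 2 *+ 2 = t by rewrite sqr_sqrtr// -mulr_natr divfK.
have pE : normal_peak s = (Num.sqrt (pi * t))^-1.
  by rewrite /normal_peak -sE; congr (Num.sqrt _)^-1; ring.
have p0 : 0 < Num.sqrt (pi * t) by rewrite sqrtr_gt0 mulr_gt0 ?pi_gt0.
have := @integral_normal_pdf R 0 s.
under eq_integral do rewrite /normal_pdf (negbTE s0) pE EFinM /normal_fun subr0 sE mulNr.
rewrite ge0_integralZl//; last first.
  apply/measurable_EFinP; apply: measurableT_comp => //.
  by apply: measurableT_comp => //; apply: measurable_funM.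
move=> H; rewrite -[LHS]mul1e -(divff (lt0r_neq0 p0)) EFinM -muleA.
by rewrite [X in (_ * X)%E]H mule1.
Qed.

Lemma enorm_sqr n (x : 'rV[R]_n) : enorm x ^+ 2 = \sum_i x ord0 i ^+ 2.
Proof. by rewrite sqr_sqrtr// sumr_ge0// => i _; rewrite sqr_ge0. Qed.

Lemma enorm_sqr_cons n (t : R) (y : 'rV[R]_n) :
  enorm (cons_rV (t, y)) ^+ 2 = t ^+ 2 + enorm y ^+ 2.
Proof.
rewrite !enorm_sqr big_ord_recl cons_rV0; congr (_ + _).
by apply: eq_bigr => i _; rewrite cons_rVS.
Qed.

Lemma measurable_enorm_sqr n :
  measurable_fun [set: 'rV[R]_n] (fun x => enorm x ^+ 2 : measurableTypeR R).
Proof.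
under eq_fun do rewrite enorm_sqr.
apply: measurable_sum => i; apply: measurable_funX; exact: measurable_coor.
Qed.

Lemma measurable_expR_enorm n (t : R) : measurable_fun [set: 'rV[R]_n]
  (fun x => expR (- (enorm x ^+ 2 / t)) : measurableTypeR R).
Proof.
apply: measurableT_comp => //; apply: measurableT_comp => //.
by apply: measurable_funM => //; exact: measurable_enorm_sqr.
Qed.

Lemma integral_expR_enorm n (t : R) : 0 < t ->
  (\int[lebesgue_rV n]_x (expR (- (enorm x ^+ 2 / t)))%:E)%E =
  (Num.sqrt (pi * t) ^+ n)%:E.
Proof.
move=> t0; elim: n => [|n IH].
  rewrite (eq_integral (cst 1%:E)).
    by rewrite integral_cst//= diracE in_setT mul1e expr0.
  by move=> x _; rewrite enorm_sqr big_ord0 mul0r oppr0 expR0.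
rewrite /= /lebesgue_rV_step ge0_integral_pushforward//; first last.
- apply/measurable_EFinP; exact: measurable_expR_enorm.
- exact: measurable_cons_rV.
rewrite preimage_setT.
pose F (z : measurableTypeR R * 'rV[R]_n) : \bar R :=
  ((expR (- (z.1 ^+ 2 / t)))%:E * (expR (- (enorm z.2 ^+ 2 / t)))%:E)%E.
rewrite (eq_integral F) => [|[a y] _]; last first.
  by rewrite /F /= enorm_sqr_cons mulrDl opprD expRD EFinM.
rewrite (fubini_tonelli1 F).
- rewrite /fubini_F /F/=.
  under eq_integral => a _.
    rewrite ge0_integralZl//; last first.
      by apply/measurable_EFinP; exact: measurable_expR_enorm.
    rewrite IH muleC; over.
  rewrite ge0_integralZl//.
  - by rewrite [X in (_ * X)%E]integral_expR_sqr// -EFinM exprSr.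
  - apply/measurable_EFinP; apply: measurableT_comp => //.
    by apply: measurableT_comp => //; apply: measurable_funM.
- apply: emeasurable_funM; apply/measurable_EFinP.
    apply: measurableT_comp => //; apply: measurableT_comp => //.
    apply: measurable_funM => //; apply: measurable_funX.
    exact: measurable_fst.
  exact: (measurableT_comp (measurable_expR_enorm t) measurable_snd).
- by move=> z; rewrite mule_ge0.
Qed.

(** The prefactor is that of [gaussian tau], so this is not normalized. A quarter of the exponent is
    what remains in [gaussian_dist_le]: half is lost in comparing the shifted Gaussian with the
    original one, half of the rest in absorbing a linear factor. *)
Definition wide_gaussian {d : nat} (tau : R) (x : 'rV[R]_d) : R :=
  (pi * tau) `^ (- (d%:R / 2)) * expR (- (enorm x ^+ 2 / (4 * tau))).

Lemma wide_gaussian_ge0 d tau (x : 'rV[R]_d) : 0 <= wide_gaussian tau x.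
Proof. by rewrite mulr_ge0 ?powR_ge0 ?expR_ge0. Qed.

Lemma gaussian_ge0 d tau (x : 'rV[R]_d) : 0 <= gaussian tau x.
Proof. by rewrite mulr_ge0 ?powR_ge0 ?expR_ge0. Qed.

Lemma measurable_wide_gaussian d tau :
  measurable_fun [set: 'rV[R]_d] (wide_gaussian tau : _ -> measurableTypeR R).
Proof. by apply: measurable_funM => //; exact: measurable_expR_enorm. Qed.

Lemma measurable_gaussian d tau :
  measurable_fun [set: 'rV[R]_d] (gaussian tau : _ -> measurableTypeR R).
Proof. by apply: measurable_funM => //; exact: measurable_expR_enorm. Qed.

Lemma gaussian_coef d (tau : R) : 0 < tau ->
  (pi * tau) `^ (- (d%:R / 2)) = (Num.sqrt (pi * tau) ^+ d)^-1 :> R.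
Proof.
move=> t0; have p0 : 0 <= pi * tau :> R by rewrite mulr_ge0 ?pi_ge0 ?ltW.
by rewrite powRN [d%:R / 2]mulrC powRrM powR12_sqrt// powR_mulrn ?sqrtr_ge0.
Qed.

Let integral_coef_expR d (tau t : R) : 0 < tau -> 0 < t ->
  (\int[lebesgue_rV d]_x ((pi * tau) `^ (- (d%:R / 2)) *
     expR (- (enorm x ^+ 2 / t)))%:E)%E =
  ((Num.sqrt (pi * t) / Num.sqrt (pi * tau)) ^+ d)%:E.
Proof.
move=> tau0 t0; under eq_integral do rewrite EFinM.
rewrite ge0_integralZl ?lee_fin ?powR_ge0//; last first.
  by apply/measurable_EFinP; exact: measurable_expR_enorm.
by rewrite integral_expR_enorm// gaussian_coef// -EFinM mulrC expr_div_n.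
Qed.

Lemma integral_gaussian d (tau : R) : 0 < tau ->
  (\int[lebesgue_rV d]_x (gaussian tau x)%:E)%E = 1%E.
Proof.
move=> t0; rewrite integral_coef_expR// divff ?expr1n//.
by rewrite gt_eqF// sqrtr_gt0 mulr_gt0 ?pi_gt0.
Qed.

Lemma integral_wide_gaussian d (tau : R) : 0 < tau ->
  (\int[lebesgue_rV d]_x (wide_gaussian tau x)%:E)%E = (2 ^+ d)%:E.
Proof.
move=> t0; rewrite integral_coef_expR ?mulr_gt0//.
have -> : pi * (4 * tau) = 2 ^+ 2 * (pi * tau) :> R by rewrite expr2; ring.
rewrite sqrtrM ?exprn_ge0// sqrtr_sqr ger0_norm// mulfK//.
by rewrite gt_eqF// sqrtr_gt0 mulr_gt0 ?pi_gt0.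
Qed.

Lemma expR_opp_dist_le (a b m : R) : m <= a -> m <= b ->
  `|expR (- b) - expR (- a)| <= `|b - a| * expR (- m).
Proof.
wlog ab : a b / a <= b => [H ma mb|ma mb].
  by have [/H|/ltW /H] := leP a b; [exact|rewrite distrC [`|b - a|]distrC; exact].
rewrite distrC !ger0_norm ?subr_ge0 ?ler_expR ?lerN2//.
have -> : expR (- b) = expR (- a) * expR (a - b) by rewrite -expRD; congr expR; ring.
rewrite -{1}[expR (- a)]mulr1 -mulrBr mulrC ler_pM ?expR_ge0 ?ler_expR ?lerN2//.
  by rewrite subr_ge0 -expR0 ler_expR; lra.
by have := @expR_ge1Dx R (a - b); lra.
Qed.

(* AM-GM in each coordinate replaces the triangle inequality for [enorm]. *)
Lemma gaussian_dist_le d tau eps (u v : 'rV[R]_d) : 0 < tau -> 0 <= eps ->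
  eps <= Num.sqrt tau -> enorm v <= eps ->
  `|gaussian tau (u + v) - gaussian tau u| <=
    4 * expR 1 * (eps / Num.sqrt tau) * wide_gaussian tau u.
Proof.
move=> t0 eps0 epst ve.
have st0 : 0 < Num.sqrt tau by rewrite sqrtr_gt0.
pose e := eps / Num.sqrt tau.
have e0 : 0 <= e by rewrite divr_ge0 ?sqrtr_ge0.
have e1 : e <= 1 by rewrite ler_pdivrMr// mul1r.
have epsE : eps ^+ 2 = e ^+ 2 * tau.
  by rewrite /e expr_div_n sqr_sqrtr ?(ltW t0)// divfK ?gt_eqF.
have v2 : enorm v ^+ 2 <= e ^+ 2 * tau.
  by rewrite -epsE ler_sqr ?nnegrE ?sqrtr_ge0.
pose a := enorm u ^+ 2 / tau; pose b := enorm (u + v) ^+ 2 / tau.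
have a0 : 0 <= a by rewrite divr_ge0 ?sqr_ge0 ?ltW.
have uE : enorm u ^+ 2 = a * tau by rewrite divfK ?gt_eqF.
have uvE : enorm (u + v) ^+ 2 = b * tau by rewrite divfK ?gt_eqF.
have ba : a / 2 - 1 <= b.
  rewrite -(ler_pM2r t0) -uvE mulrBl mul1r mulrAC -uE.
  apply: (@le_trans _ _ (enorm u ^+ 2 / 2 - enorm v ^+ 2)).
    by rewrite lerD2l lerN2 (le_trans v2)// ler_piMl ?(ltW t0)// expr_le1.
  rewrite !enorm_sqr mulr_suml -sumrB; apply: ler_sum => i _; rewrite mxE.
  by have := sqr_ge0 (u ord0 i + 2 * v ord0 i); rewrite !expr2; lra.
have bae : `|b - a| <= e * (a + 2).
  rewrite -(ler_pM2r t0) -[X in _ * X <= _](ger0_norm (ltW t0)) -normrM.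
  rewrite mulrBl -uvE -uE.
  (* The AM-GM weights below involve 1 / e; for e = 0 the shift [v] vanishes. *)
  have [ez|en0] := eqVneq e 0.
    have : enorm v ^+ 2 = 0.
      by apply/eqP; rewrite eq_le sqr_ge0 andbT (le_trans v2)// ez expr0n mul0r.
    rewrite enorm_sqr => /psumr_eq0P v0.
    have -> : u + v = u.
      apply/rowP => i; rewrite mxE.
      have /eqP := v0 (fun i _ => sqr_ge0 (v ord0 i)) i isT.
      by rewrite sqrf_eq0 => /eqP ->; rewrite addr0.
    by rewrite subrr normr0 ez !mul0r.
  have ep : 0 < e by rewrite lt_def en0.
  apply: (@le_trans _ _ (e * enorm u ^+ 2 + (e^-1 + 1) * enorm v ^+ 2)).
    rewrite !enorm_sqr -sumrB (le_trans (ler_norm_sum _ _ _))// !mulr_sumr -big_split/=.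
    apply: ler_sum => i _; rewrite mxE.
    set x := u ord0 i; set y := v ord0 i.
    have h1 : 0 <= e * (x - y / e) ^+ 2 by rewrite mulr_ge0 ?sqr_ge0.
    have h2 : 0 <= e * (x + y / e) ^+ 2 by rewrite mulr_ge0 ?sqr_ge0.
    have E1 : e * (x - y / e) ^+ 2 = e * x ^+ 2 - 2 * x * y + e^-1 * y ^+ 2 by field.
    have E2 : e * (x + y / e) ^+ 2 = e * x ^+ 2 + 2 * x * y + e^-1 * y ^+ 2 by field.
    rewrite E1 in h1; rewrite E2 in h2.
    have := sqr_ge0 y; rewrite ler_norml !expr2 in h1 h2 *; move=> h3.
    by apply/andP; split; lra.
  have ei0 : 0 <= e^-1 + 1 by rewrite addr_ge0// invr_ge0.
  rewrite (le_trans (lerD (lexx _) (ler_wpM2l ei0 v2)))// uE.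
  have -> : (e^-1 + 1) * (e ^+ 2 * tau) = (e + e ^+ 2) * tau by field.
  rewrite mulrA -mulrDl ler_wpM2r ?(ltW t0)//.
  have : e ^+ 2 <= e by rewrite expr2 ler_piMl.
  by lra.
rewrite /gaussian /wide_gaussian -mulrBr normrM ger0_norm ?powR_ge0//.
rewrite mulrCA ler_wpM2l ?powR_ge0// -/a -/b -/e.
have aha : a / 2 - 1 <= a by lra.
rewrite (le_trans (expR_opp_dist_le aha ba))//.
rewrite (le_trans (ler_wpM2r (expR_ge0 _) bae))//.
have -> : enorm u ^+ 2 / (4 * tau) = a / 4 by rewrite /a invfM mulrA mulrAC.
(* One of the two equal factors bounds a + 2 by 4, the other is the wide Gaussian, and the 1 yields
   the factor [expR 1]. *)
have -> : - (a / 2 - 1) = 1 + (- (a / 4) + - (a / 4)) by lra.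
rewrite !expRD.
have a4 : (a + 2) * expR (- (a / 4)) <= 4.
  rewrite expRN ler_pdivrMr ?expR_gt0//.
  by have := @expR_ge1Dx R (a / 4); lra.
rewrite [leLHS](_ : _ = (expR 1 * e * expR (- (a / 4))) * ((a + 2) * expR (- (a / 4)))); last by ring.
rewrite [leRHS](_ : _ = (expR 1 * e * expR (- (a / 4))) * 4); last by ring.
by rewrite ler_wpM2l// !mulr_ge0 ?expR_ge0.
Qed.

End gaussians.

(** * Young's inequality *)

Section monotonicity.
Context d (T : measurableType d) (R : realType).
Variable mu : {measure set T -> \bar R}.
Local Open Scope ereal_scope.

(* Unlike [ge0_le_integral], no measurability: the integral of a nonnegative
   function is a supremum over the simple functions below it. *)
Lemma ge0_le_integral_nonmeasurable (f g : T -> \bar R) :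
  (forall x, 0 <= f x) -> (forall x, f x <= g x) ->
  \int[mu]_x f x <= \int[mu]_x g x.
Proof.
move=> f0 fg; have g0 x : 0 <= g x by exact: le_trans (fg x).
rewrite !ge0_integralTE//; apply: le_ereal_sup => _ [h hf <-].
by exists h => // x; exact: le_trans (fg x).
Qed.

Lemma Lnorm_le (f g : T -> \bar R) (r : R) : (0 < r)%R ->
  (forall x, `|f x| <= g x) -> 'N[mu]_r%:E[f] <= 'N[mu]_r%:E[g].
Proof.
move=> r0 fg; rewrite unlock; apply: gt0_ler_poweR.
- by rewrite invr_ge0 ltW.
- by rewrite in_itv/= leey andbT integral_ge0// => x _; exact: poweR_ge0.
- by rewrite in_itv/= leey andbT integral_ge0// => x _; exact: poweR_ge0.
apply: ge0_le_integral_nonmeasurable => x; first exact: poweR_ge0.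
have g0 : 0 <= g x by exact: le_trans (fg x).
apply: gt0_ler_poweR; rewrite ?in_itv/= ?abse_ge0 ?leey//; first exact: ltW.
by rewrite (le_trans (fg x))// lee_abs.
Qed.

End monotonicity.

Section young.
Context {R : realType} (n : nat).
Local Notation V := 'rV[R]_n.

Lemma measurable_subr_rV : measurable_fun [set: V * V] (fun z : V * V => z.1 - z.2).
Proof.
apply/measurable_fun_rVP => i; under eq_fun do rewrite !mxE.
apply: measurable_funB.
  exact: (measurableT_comp (measurable_coor i) measurable_fst).
exact: (measurableT_comp (measurable_coor i) measurable_snd).
Qed.

Lemma integral_rV_measure_preserving (T : V -> V) (h : V -> \bar R) :
  measurable_fun setT T ->
  (forall E, measurable E -> lebesgue_rV n (T @^-1` E) = lebesgue_rV n E) ->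
  measurable_fun setT h -> (forall x, 0 <= h x)%E ->
  (\int[lebesgue_rV n]_x h (T x) = \int[lebesgue_rV n]_x h x)%E.
Proof.
move=> mT TE mh h0.
rewrite [LHS](_ : _ = \int[pushforward (lebesgue_rV n) T]_y h y)%E.
  by apply: eq_measure_integral => E mE _; exact: TE.
by rewrite ge0_integral_pushforward// preimage_setT.
Qed.

Lemma integral_rV_reflect (x : V) (h : V -> \bar R) :
  measurable_fun setT h -> (forall x, 0 <= h x)%E ->
  (\int[lebesgue_rV n]_y h (x - y)%R = \int[lebesgue_rV n]_y h y)%E.
Proof.
move=> mh h0.
have mT : measurable_fun setT (fun y : V => x - y).
  exact: (measurableT_comp measurable_subr_rV (measurable_pair1 x)).
apply: (integral_rV_measure_preserving (T := fun y => x - y)) => // E mE.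
have uN : (-1)%:M \in @unitmx R n by rewrite unitmxE det_scalar unitrX// unitrN1.
have mE' : measurable ((fun z => z + x) @^-1` E).
  by rewrite -[X in measurable X]setTI; exact: measurable_fun_addr_rV.
rewrite -(lebesgue_rV_translate x mE) -(scales_volume_unitmx uN mE').
rewrite det_scalar normrX normrN1 expr1n mul1e; congr (lebesgue_rV n _).
by apply/seteqP; split => y /=; rewrite mul_mx_scalar scaleN1r addrC.
Qed.

Lemma integral_rV_translate (y : V) (h : V -> \bar R) :
  measurable_fun setT h -> (forall x, 0 <= h x)%E ->
  (\int[lebesgue_rV n]_x h (x - y)%R = \int[lebesgue_rV n]_x h x)%E.
Proof.
move=> mh h0; apply: (integral_rV_measure_preserving (T := fun x => x - y)) => //.
  exact: measurable_fun_addr_rV.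
by move=> E mE; exact: (lebesgue_rV_translate (- y)).
Qed.

Variables (H : V -> R) (M : R).
Hypotheses (H0 : forall x, 0 <= H x)
  (mH : measurable_fun [set: V] (H : V -> measurableTypeR R)) (M0 : 0 <= M)
  (HM : (\int[lebesgue_rV n]_x (H x)%:E)%E = M%:E).

(** With values in the extended reals, as it may be infinite at some points. *)
Definition abs_convolution (u : V -> R) (x : V) : \bar R :=
  (\int[lebesgue_rV n]_y (H (x - y) * `|u y|)%:E)%E.

Let mHx x : measurable_fun [set: V] (fun y => H (x - y) : measurableTypeR R).
Proof.
apply: (measurableT_comp mH).
exact: (measurableT_comp measurable_subr_rV (measurable_pair1 x)).
Qed.

Let intH x : (\int[lebesgue_rV n]_y (H (x - y))%:E)%E = M%:E.
Proof.
rewrite (@integral_rV_reflect x (EFin \o H))//; exact/measurable_EFinP.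
Qed.

(** Hölder's inequality with the kernel split as H^(1/r') H^(1/r), the first factor having r'-norm
    M^(1/r'). For r = 1, where r' would be infinite, the claim is an equality. *)
Let pointwise (u : V -> R) (r : R) x : measurable_fun [set: V] (u : V -> measurableTypeR R) ->
  1 <= r -> (abs_convolution u x `^ r <=
    (M `^ (r - 1))%:E * \int[lebesgue_rV n]_y (H (x - y) * `|u y| `^ r)%:E)%E.
Proof.
move=> mu; rewrite le_eqVlt => /predU1P[<-|r1].
  rewrite subrr powRr0 mul1e poweRe1; last first.
    by apply: integral_ge0 => y _; rewrite lee_fin mulr_ge0.
  by rewrite le_eqVlt; apply/orP; left; apply/eqP; apply: eq_integral => y _; rewrite powRr1.
have r0 : 0 < r by lra.
pose r' := r / (r - 1).
have r'0 : 0 < r' by rewrite divr_gt0// subr_gt0.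
have rr : r'^-1 + r^-1 = 1 by rewrite /r' invf_div -[X in _ + X]mul1r -mulrDl subrK divff ?gt_eqF.
pose f (y : V) : R := H (x - y) `^ r'^-1; pose g (y : V) : R := H (x - y) `^ r^-1 * `|u y|.
have mf : measurable_fun [set: V] (f : V -> measurableTypeR R).
  exact: (measurableT_comp (measurable_powR _) (mHx x)).
have mg : measurable_fun [set: V] (g : V -> measurableTypeR R).
  apply: measurable_funM; first exact: (measurableT_comp (measurable_powR _) (mHx x)).
  exact: measurableT_comp.
have f0 (y : V) : 0 <= f y by rewrite powR_ge0.
have g0 (y : V) : 0 <= g y by rewrite mulr_ge0 ?powR_ge0.
have fgE (y : V) : f y * g y = H (x - y) * `|u y|.
  have [Hz|Hn] := eqVneq (H (x - y)) 0.
    by rewrite /f Hz powR0 ?invr_neq0 ?gt_eqF// !mul0r.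
  by rewrite /f /g mulrA -powRD ?Hn ?implybT// rr powRr1.
have := hoelder (lebesgue_rV n) mf mg r'0 r0 rr.
rewrite Lnorm1 (eq_integral (fun y : V => (H (x - y) * `|u y|)%:E)); last first.
  by move=> y _; rewrite -fgE /= ger0_norm// mulr_ge0.
rewrite -/(abs_convolution u x) => hf.
have cv0 : (0 <= abs_convolution u x)%E.
  by apply: integral_ge0 => y _; rewrite lee_fin mulr_ge0.
have Nf : ('N[lebesgue_rV n]_r'%:E[EFin \o f] = (M `^ r'^-1)%:E)%E.
  rewrite unlock -poweR_EFin -(intH x); congr (_ `^ _)%E.
  by apply: eq_integral => y _; rewrite /= ger0_norm// -powRrM mulVf ?gt_eqF// powRr1.
have Ng : ('N[lebesgue_rV n]_r%:E[EFin \o g] `^ r =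
    \int[lebesgue_rV n]_y (H (x - y) * `|u y| `^ r)%:E)%E.
  rewrite poweR_Lnorm ?gt_eqF//; apply: eq_integral => y _ /=.
  by rewrite ger0_norm// powRM ?powR_ge0// -powRrM mulVf ?gt_eqF// powRr1.
rewrite -Ng.
have -> : (M `^ (r - 1))%:E = ((M `^ r'^-1)%:E `^ r)%E.
  rewrite poweR_EFin -powRrM; congr (_ `^ _)%:E.
  by rewrite /r' invf_div divfK// gt_eqF.
rewrite -poweRM ?lee_fin ?powR_ge0 ?Lnorm_ge0// -Nf.
apply: gt0_ler_poweR; rewrite ?(ltW r0) ?in_itv/= ?leey ?cv0//.
by rewrite mule_ge0// Lnorm_ge0.
Qed.

(** Integrating [pointwise] in x and exchanging the integrals by Tonelli gives one more factor M,
    that is M^r in all, before the r-th root. *)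
Theorem young_Lnorm (u : V -> R) (r : R) :
  measurable_fun [set: V] (u : V -> measurableTypeR R) -> 1 <= r ->
  ('N[lebesgue_rV n]_r%:E[abs_convolution u] <=
   M%:E * 'N[lebesgue_rV n]_r%:E[EFin \o u])%E.
Proof.
move=> mu r1; have r0 : 0 < r by lra.
pose K (z : V * V) := (H (z.1 - z.2) * `|u z.2| `^ r)%:E.
have mK : measurable_fun setT K.
  apply/measurable_EFinP; apply: measurable_funM.
    exact: (measurableT_comp mH measurable_subr_rV).
  apply: (measurableT_comp (measurable_powR _)); apply: measurableT_comp => //.
  exact: (measurableT_comp mu measurable_snd).
have K0 z : (0 <= K z)%E by rewrite lee_fin mulr_ge0 ?powR_ge0.
have ME : ((M `^ r)%:E `^ r^-1 = M%:E)%E.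
  by rewrite poweR_EFin -powRrM divff ?gt_eqF// powRr1.
rewrite -ME unlock -poweRM ?lee_fin ?powR_ge0//; last first.
  by apply: integral_ge0 => x _; exact: poweR_ge0.
apply: gt0_ler_poweR.
- by rewrite invr_ge0 ltW.
- by rewrite in_itv/= leey andbT integral_ge0// => x _; exact: poweR_ge0.
- by rewrite in_itv/= leey andbT mule_ge0 ?lee_fin ?powR_ge0// integral_ge0.
have cv0 x : (0 <= abs_convolution u x)%E.
  by apply: integral_ge0 => y _; rewrite lee_fin mulr_ge0.
apply: (@le_trans _ _ (\int[lebesgue_rV n]_x ((M `^ (r - 1))%:E *
    \int[lebesgue_rV n]_y K (x, y)))%E).
  apply: ge0_le_integral_nonmeasurable => x; first exact: poweR_ge0.
  by rewrite gee0_abs//; exact: pointwise.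
rewrite ge0_integralZl ?lee_fin ?powR_ge0//; last 2 first.
- exact: (measurable_fun_fubini_tonelli_F K).
- by move=> x _; exact: integral_ge0.
rewrite (fubini_tonelli K)//.
rewrite [X in (_ * X <= _)%E](eq_integral (fun y : V => M%:E * (`|u y| `^ r)%:E)%E) => [|y _]; last first.
  rewrite /K /=; under eq_integral do rewrite EFinM muleC.
  rewrite ge0_integralZl ?lee_fin ?powR_ge0//; last 2 first.
  - apply/measurable_EFinP; apply: (measurableT_comp mH).
    exact: measurable_fun_addr_rV.
  - by move=> x _; rewrite lee_fin.
  rewrite (@integral_rV_translate y (EFin \o H));
    [|exact/measurable_EFinP|by move=> x; rewrite lee_fin].
  by rewrite [X in (_ * X)%E]HM muleC.
rewrite ge0_integralZl ?lee_fin ?M0//; last first.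
  apply/measurable_EFinP; apply: (measurableT_comp (measurable_powR _)).
  exact: measurableT_comp.
rewrite muleA -EFinM [X in X%:E]mulrC mulr_powRB1 ?M0//.
Qed.

End young.

(** * Smoothing the deformation difference *)

Section deformation_integrals.
Context {R : realType} (n : nat).
Local Notation V := 'rV[R]_n.
Variables (A B : set V) (phi : V -> V) (f : V -> R).
Hypotheses (oA : open A) (oB : open B) (bij : set_bij B A phi) (C1 : C1_on B phi).
Hypotheses (mf : measurable_fun [set: V] (f : V -> measurableTypeR R))
  (fA : {ae lebesgue_rV n, forall x, ~ A x -> f x = 0}).
Local Notation g := (deformation B phi f).

Let mB : measurable B. Proof. exact: open_measurable_rV. Qed.
Let mA : measurable A. Proof. exact: open_measurable_rV. Qed.
Let mphi : measurable_fun B phi.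
Proof. by have := continuous_in_measurable_fun_rV oB (C1_on_continuous C1). Qed.

Lemma deformationE z : B z -> g z = f (phi z) * jac phi z.
Proof. by move=> Bz; rewrite /deformation patchE mem_set. Qed.

Lemma deformation_out z : ~ B z -> g z = 0.
Proof. by move=> Bz; rewrite /deformation patchE memNset. Qed.

Lemma measurable_deformation : measurable_fun [set: V] (g : V -> measurableTypeR R).
Proof.
apply/measurable_restrict => //; rewrite setTI; apply: measurable_funM.
  exact: (measurableT_comp mf mphi).
exact: (measurable_jac oB C1).
Qed.

(** As [h] vanishes wherever [f] does, its integral is almost everywhere carried by A, where the
    change of variables applies. *)
Lemma ge0_integral_deformation (h : V -> \bar R) : measurable_fun setT h ->
  (forall y, 0 <= h y)%E -> (forall y, f y = 0 -> h y = 0%E) ->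
  (\int[lebesgue_rV n]_y h y =
   \int[lebesgue_rV n]_z ((fun x => h (phi x) * (jac phi x)%:E) \_ B) z)%E.
Proof.
move=> mh h0 hf.
rewrite -integral_mkcond -(ge0_change_of_variables oA oB bij C1)//.
rewrite [RHS]integral_mkcond; apply: ge0_ae_eq_integral => //.
- by apply/(measurable_restrict _ mA) => //; exact: measurable_funTS.
- by move=> y _; rewrite patchE; case: ifP.
- apply: filterS fA => y fy _; rewrite patchE; case: ifPn => // /negP yA.
  by apply: hf; apply: fy => Ay; apply: yA; rewrite inE.
Qed.

Variable K : V -> R.
Hypothesis mK : measurable_fun [set: V] (K : V -> measurableTypeR R).
Local Notation F := (fun y => (K y * f y)%:E).
Local Notation G := (fun z => (K (phi z) * g z)%:E).

Let mF : measurable_fun setT F.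
Proof. by apply/measurable_EFinP; exact: measurable_funM. Qed.

Let GE (s : R -> R) z : s 0 = 0 -> (forall a b, 0 <= b -> s (a * b) = s a * b) ->
  (s (K (phi z) * g z))%:E =
  ((fun x => (s (K (phi x) * f (phi x)))%:E * (jac phi x)%:E)%E \_ B) z.
Proof.
move=> s0 sM; rewrite patchE; case: ifPn => [/set_mem Bz|/negP zB].
  by rewrite deformationE// mulrA sM ?jac_ge0// EFinM.
by rewrite deformation_out ?mulr0 ?s0// => Bz; apply: zB; rewrite inE.
Qed.

(** Here [s] stands for the positive part, the negative part and the absolute value; positive
    homogeneity lets the Jacobian factor pass through it. *)
Let int_eq (s : R -> R) : s 0 = 0 -> (forall a b, 0 <= b -> s (a * b) = s a * b) ->
  (forall a, 0 <= s a) -> measurable_fun [set: measurableTypeR R] (s : _ -> measurableTypeR R) ->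
  (\int[lebesgue_rV n]_y (s (K y * f y))%:E =
   \int[lebesgue_rV n]_z (s (K (phi z) * g z))%:E)%E.
Proof.
move=> s0 sM sge ms.
rewrite (@ge0_integral_deformation (fun y => (s (K y * f y))%:E)).
- by apply: eq_integral => z _; rewrite GE.
- apply/measurable_EFinP; apply: (measurableT_comp ms); exact: measurable_funM.
- by move=> y; rewrite lee_fin.
- by move=> y ->; rewrite mulr0 s0.
Qed.

Lemma integral_deformation :
  (\int[lebesgue_rV n]_y (K y * f y)%:E =
   \int[lebesgue_rV n]_z (K (phi z) * g z)%:E)%E.
Proof.
have maxM (a b : R) : 0 <= b -> Num.max (a * b) 0 = Num.max a 0 * b.
  by move=> b0; rewrite maxr_pMl// mul0r.
rewrite [LHS]integralE [RHS]integralE; congr (_ - _)%E.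
- transitivity (\int[lebesgue_rV n]_y (Num.max (K y * f y) 0)%:E)%E.
    by apply: eq_integral => y _; rewrite funeposE EFin_max.
  rewrite (int_eq (s := fun a => Num.max a 0)).
  + by apply: eq_integral => y _; rewrite funeposE EFin_max.
  + by rewrite maxxx.
  + exact: maxM.
  + by move=> a; rewrite le_max lexx orbT.
  + exact: measurable_maxr.
- transitivity (\int[lebesgue_rV n]_y (Num.max (- (K y * f y)) 0)%:E)%E.
    by apply: eq_integral => y _; rewrite funenegE EFin_max.
  rewrite (int_eq (s := fun a => Num.max (- a) 0)).
  + by apply: eq_integral => y _; rewrite funenegE EFin_max.
  + by rewrite oppr0 maxxx.
  + by move=> a b b0; rewrite -mulNr maxM.
  + by move=> a; rewrite le_max lexx orbT.
  + by apply: measurable_maxr.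
Qed.

Lemma integrable_deformation : (lebesgue_rV n).-integrable setT F ->
  (lebesgue_rV n).-integrable setT G.
Proof.
have mG : measurable_fun setT G.
  apply/measurable_EFinP.
  rewrite (_ : (fun z => _) = (fun z => K (phi z) * (f (phi z) * jac phi z)) \_ B).
    apply/(measurable_restrict _ mB) => //; rewrite setTI.
    apply: measurable_funM; first exact: (measurableT_comp mK mphi).
    apply: measurable_funM; first exact: (measurableT_comp mf mphi).
    exact: (measurable_jac oB C1).
  apply/funext => z; rewrite patchE; case: ifPn => [/set_mem Bz|/negP zB].
    by rewrite deformationE.
  by rewrite deformation_out ?mulr0// => Bz; apply: zB; rewrite inE.
move=> /integrableP[_ Foo]; apply/integrableP; split => //.
rewrite [X in (X < _)%E](_ : _ = \int[lebesgue_rV n]_y `|F y|)%E//.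
symmetry; apply: (int_eq (s := fun a => `|a|)) => //.
- by rewrite normr0.
- by move=> a b b0; rewrite normrM (ger0_norm b0).
- exact: normr_measurable.
Qed.

End deformation_integrals.

(** * The estimate at a single scale *)

Section smoothing_bounds.
Context {R : realType} (n : nat).
Local Notation V := 'rV[R]_n.
Local Notation lam := (lebesgue_rV n).

(** The product is at most K where |h| <= 1 and at most c |h|^r elsewhere, so the integrable
    function K + c |h|^r dominates it. *)
Lemma integrable_bounded_mul (K h : V -> R) (c r : R) :
  measurable_fun [set: V] (K : V -> measurableTypeR R) ->
  measurable_fun [set: V] (h : V -> measurableTypeR R) ->
  (forall y, 0 <= K y) -> (forall y, K y <= c) ->
  (\int[lam]_y (K y)%:E < +oo)%E -> 1 <= r ->
  ('N[lam]_r%:E[EFin \o h] < +oo)%E ->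
  lam.-integrable setT (fun y => (K y * h y)%:E).
Proof.
move=> mK mh K0 Kc Koo r1 hoo; have r0 : 0 < r by lra.
have c0 : 0 <= c by rewrite (le_trans (K0 0)).
have mhr : measurable_fun setT (fun y => (`|h y| `^ r)%:E).
  apply/measurable_EFinP; apply: (measurableT_comp (measurable_powR _)).
  exact: measurableT_comp.
apply/integrableP; split; first by apply/measurable_EFinP; exact: measurable_funM.
apply: (@le_lt_trans _ _ (\int[lam]_y ((K y)%:E + c%:E * (`|h y| `^ r)%:E))%E).
  apply: ge0_le_integral_nonmeasurable => y; first exact: abse_ge0.
  rewrite abse_EFin normrM ger0_norm// -EFinM -EFinD lee_fin.
  have [h1|h1] := leP `|h y| 1.
    rewrite (@le_trans _ _ (K y))//; first by rewrite ler_piMr.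
    by rewrite lerDl mulr_ge0// powR_ge0.
  rewrite (@le_trans _ _ (c * `|h y| `^ r))//; last by rewrite lerDr.
  by rewrite ler_pM// le1r_powR// ltW.
rewrite ge0_integralD//; last 4 first.
- by move=> y _; rewrite lee_fin.
- exact/measurable_EFinP.
- by move=> y _; rewrite mule_ge0 ?lee_fin// powR_ge0.
- exact: measurable_funeM.
rewrite lte_add_pinfty// ge0_integralZl ?lee_fin//.
rewrite lte_mul_pinfty ?lee_fin//.
have := @poweR_Lnorm _ _ _ lam (EFin \o h) r (lt0r_neq0 r0).
under [X in _ = X]eq_integral do rewrite /=.
by move=> <-; exact: poweR_lty.
Qed.

Lemma gaussian_le (tau : R) (x : V) : 0 < tau ->
  gaussian tau x <= (pi * tau) `^ (- (n%:R / 2)).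
Proof.
move=> t0; rewrite /gaussian ler_piMr ?powR_ge0// -expR0 ler_expR oppr_le0.
by rewrite divr_ge0 ?sqr_ge0 ?ltW.
Qed.

(** The convolution takes the value 0 where its integral is infinite; this lets it be bounded by the
    extended-real integral. *)
Lemma abse_fine_le (x : \bar R) : (`|fine x|%:E <= `|x|)%E.
Proof. by case: x => [x| |] //=; rewrite ?normr0 ?leey. Qed.

(** The constant of [gaussian_dist_le] times the mass of the wide Gaussian. Being at least 2, it
    also covers the crude bound |f - f_phi|_r <= 2 |f|_r. *)
Definition smoothing_constant : R := 4 * expR 1 * 2 ^+ n.

Lemma smoothing_constant_ge2 : 2 <= smoothing_constant.
Proof.
have e2 : 1 + 1 <= expR 1 :> R by exact: expR_ge1Dx.
have n1 : 1 <= 2 ^+ n :> R by rewrite exprn_ege1// ler1n.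
have e4 : 2 <= 4 * expR 1 :> R by lra.
by rewrite (le_trans e4)// ler_peMr// mulr_ge0// expR_ge0.
Qed.

Variables (A B : set V) (phi : V -> V) (f : V -> R) (r : R).
Hypotheses (oA : open A) (oB : open B) (bij : set_bij B A phi) (C1 : C1_on B phi).
Hypotheses (mf : measurable_fun [set: V] (f : V -> measurableTypeR R))
  (fA : {ae lam, forall x, ~ A x -> f x = 0}) (r1 : 1 <= r).
Local Notation g := (deformation B phi f).
Local Notation Nf := ('N[lam]_r%:E[EFin \o f])%E.
Hypotheses (foo : (Nf < +oo)%E) (gf : ('N[lam]_r%:E[EFin \o g] <= Nf)%E).
Variables (tau eps : R).
Hypotheses (t0 : 0 < tau) (eps0 : 0 <= eps)
  (epsB : forall z, B z -> enorm (z - phi z) <= eps).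

Let mg : measurable_fun [set: V] (g : V -> measurableTypeR R).
Proof. exact: (measurable_deformation oB C1 mf). Qed.

Let K (x y : V) : R := gaussian tau (x - y).

Let mK x : measurable_fun [set: V] (K x : V -> measurableTypeR R).
Proof.
have mx : measurable_fun setT (fun y : V => x - y).
  exact: (measurableT_comp (@measurable_subr_rV R n) (measurable_pair1 x)).
exact: (measurableT_comp (measurable_gaussian tau) mx).
Qed.

Let intK x : (\int[lam]_y (K x y)%:E)%E = 1%E.
Proof.
rewrite (@integral_rV_reflect _ _ x (EFin \o gaussian tau)).
- exact: integral_gaussian.
- by apply/measurable_EFinP; exact: measurable_gaussian.
- by move=> y; rewrite lee_fin gaussian_ge0.
Qed.

Let intKh x (h : V -> R) : measurable_fun [set: V] (h : V -> measurableTypeR R) ->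
  ('N[lam]_r%:E[EFin \o h] < +oo)%E -> lam.-integrable setT (fun y => (K x y * h y)%:E).
Proof.
move=> mh hoo.
apply: (@integrable_bounded_mul (K x) h ((pi * tau) `^ (- (n%:R / 2))) r) => //.
- by move=> y; exact: gaussian_ge0.
- by move=> y; exact: gaussian_le.
- by rewrite intK ltry.
Qed.

Lemma convolution_le_crude (u : V -> R) x :
  measurable_fun [set: V] (u : V -> measurableTypeR R) ->
  ((`|convolution (gaussian tau) u x|)%:E <= abs_convolution (gaussian tau) u x)%E.
Proof.
move=> mu; rewrite /convolution /Rintegral; apply: (le_trans (abse_fine_le _)).
apply: (le_trans (le_abse_integral _ _ _)) => //.
  by apply/measurable_EFinP; apply: measurable_funM => //; exact: mK.
rewrite le_eqVlt; apply/orP; left; apply/eqP; apply: eq_integral => y _.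
by rewrite /= normrM (ger0_norm (gaussian_ge0 _ _)).
Qed.

Lemma convolution_deformation_le x : eps <= Num.sqrt tau ->
  ((`|convolution (gaussian tau) (fun y => f y - g y)%R x|)%:E <=
   abs_convolution (fun u => 4 * expR 1 * (eps / Num.sqrt tau) * wide_gaussian tau u)%R g x)%E.
Proof.
move=> epst; have goo := le_lt_trans gf foo.
(* Integrability of the three products allows the integral of the difference to be split, its part
   with [f] to be transported by [phi], and the parts to be recombined. *)
have if_ := intKh x mf foo; have ig := intKh x mg goo.
have iphi := integrable_deformation oA oB bij C1 mf fA (mK x) if_.
rewrite /convolution /Rintegral.
rewrite (_ : (\int[lam]_y _)%E = (\int[lam]_z ((K x (phi z) * g z)%:E - (K x z * g z)%:E))%E).
  apply: (le_trans (abse_fine_le _)).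
  apply: (le_trans (le_abse_integral _ _ _)) => //.
    exact: measurable_int (integrableB _ iphi ig).
  apply: ge0_le_integral_nonmeasurable => z; first exact: abse_ge0.
  rewrite -EFinB abse_EFin lee_fin -mulrBl normrM.
  have [Bz|Bz] := pselect (B z); last by rewrite deformation_out// normr0 !mulr0.
  rewrite ler_wpM2r// /K.
  have -> : x - phi z = (x - z) + (z - phi z) by rewrite addrA subrK.
  by apply: gaussian_dist_le => //; exact: epsB.
rewrite integralB// -(integral_deformation oA oB bij C1 mf fA (mK x)) -integralB//.
by apply: eq_integral => y _; rewrite -EFinB mulrBr.
Qed.

(** For eps <= sqrt tau the Gaussians are compared and Young's inequality is applied to f_phi with
    the wide kernel; at finer scales it is applied to f - f_phi with the Gaussian itself. The bound
    on the norm of f_phi enters in both cases. *)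
Lemma Lnorm_convolution_deformation_le :
  ('N[lam]_r%:E[EFin \o convolution (gaussian tau) (fun y => f y - g y)%R] <=
   (smoothing_constant * Num.min 1 (eps / Num.sqrt tau))%:E * Nf)%E.
Proof.
have r0 : 0 < r by rewrite (lt_le_trans ltr01).
have st0 : 0 < Num.sqrt tau by rewrite sqrtr_gt0.
have [epst|epst] := leP eps (Num.sqrt tau).
  rewrite (min_idPr _); last by rewrite ler_pdivrMr// mul1r.
  pose k := 4 * expR 1 * (eps / Num.sqrt tau).
  have k0 : 0 <= k by rewrite !mulr_ge0 ?expR_ge0 ?divr_ge0 ?sqrtr_ge0.
  apply: (@le_trans _ _ ('N[lam]_r%:E[abs_convolution (fun u => k * wide_gaussian tau u)%R g])%E).
    by apply: Lnorm_le => // x; exact: convolution_deformation_le.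
  have M0 : 0 <= k * 2 ^+ n by rewrite mulr_ge0// exprn_ge0.
  apply: (le_trans (young_Lnorm (M := k * 2 ^+ n) _ _ M0 _ mg r1)).
  - by move=> x; rewrite mulr_ge0// wide_gaussian_ge0.
  - by apply: measurable_funM => //; exact: measurable_wide_gaussian.
  - under eq_integral do rewrite EFinM.
    rewrite ge0_integralZl ?lee_fin//.
    + by rewrite integral_wide_gaussian.
    + by apply/measurable_EFinP; exact: measurable_wide_gaussian.
    + by move=> x _; rewrite lee_fin wide_gaussian_ge0.
  rewrite (_ : smoothing_constant * _ = k * 2 ^+ n); last by rewrite /smoothing_constant /k; ring.
  by apply: lee_wpmul2l; rewrite ?lee_fin.
rewrite (min_idPl _); last by rewrite ler_pdivlMr// mul1r ltW.
have mfg : measurable_fun [set: V] (fun y => f y - g y : measurableTypeR R).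
  exact: measurable_funB.
apply: (@le_trans _ _ ('N[lam]_r%:E[abs_convolution (gaussian tau) (fun y => f y - g y)%R])%E).
  by apply: Lnorm_le => // x; exact: convolution_le_crude.
apply: (le_trans (young_Lnorm (M := 1) _ _ ler01 _ mfg r1)).
- by move=> x; rewrite gaussian_ge0.
- exact: measurable_gaussian.
- exact: integral_gaussian.
rewrite mul1e.
have mNg : measurable_fun [set: V] (fun y => - g y : measurableTypeR R).
  exact: measurableT_comp.
apply: (le_trans (minkowski_EFin _ mf mNg r1)).
rewrite [X in (_ + X <= _)%E](_ : _ = 'N[lam]_r%:E[EFin \o g])%E; last first.
  by rewrite -[RHS]oppe_Lnorm.
apply: (le_trans (leeD (lexx _) gf)).
rewrite mulr1 -[X in (X + X)%E]mul1e -ge0_muleDl ?lee_fin// -EFinD.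
by apply: lee_wpmul2r; rewrite ?Lnorm_ge0// lee_fin smoothing_constant_ge2.
Qed.

End smoothing_bounds.

(** * Summation over the scales *)

Section scale_series.
Context {R : realType}.

Lemma nneseries_le (u : nat -> \bar R) (M : \bar R) :
  (forall k, 0 <= u k)%E -> (forall m, \sum_(0 <= k < m) u k <= M)%E ->
  (\sum_(0 <= k <oo) u k <= M)%E.
Proof.
move=> u0 uM; apply: lime_le; first by apply: is_cvg_nneseries.
by near=> m; exact: uM.
Unshelve. all: by end_near. Qed.

Lemma Delta_ge0 (alpha p s : R) : 0 < alpha -> 0 <= s -> s < 1 -> 0 <= Delta alpha p s.
Proof.
move=> a0 s0 s1; rewrite /Delta; case: eqP => // /eqP sn0.
have sp : 0 < s by rewrite lt_def sn0.
case: ltgtP => [_|_|_].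
- by rewrite divr_ge0 ?powR_ge0.
- by rewrite divr_ge0// le_min powR_ge0 ler01.
- by rewrite mulr_ge0 ?powR_ge0.
Qed.

Lemma trunc_sum_Delta (p alpha q s : R) m : 0 < q -> q < 1 -> 1 <= p -> 0 < alpha ->
  0 <= s -> s < 1 ->
  trunc_sum p alpha q s m <= (2 * (Delta alpha p s / (1 - q))) `^ p.
Proof.
move=> q0 q1 p1 a0; rewrite le_eqVlt => /predU1P[<- _|s0 s1]; last exact: trunc_sum_Delta_gt0.
rewrite /trunc_sum big1 ?powR_ge0// => k _.
by rewrite mul0r (min_idPr _)// powR0 ?mulr0// gt_eqF// (lt_le_trans ltr01).
Qed.

(** [N k] stands for the norm at scale k. With q = sqrt omega the weight is the p-th power of
    tau_0^(alpha/2) (q^k)^alpha, so each partial sum is at most a multiple of [trunc_sum], whose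
    bound does not depend on the number of terms. *)
Lemma series_scale_le (alpha p tau0 omega s F : R) (N : nat -> \bar R) :
  1 <= p -> 0 < alpha -> 0 < tau0 -> 0 < omega -> omega < 1 ->
  0 <= s -> s < 1 -> 0 <= F -> (forall k, 0 <= N k)%E ->
  (forall k, N k <= (F * Num.min 1 (s / (omega `^ 2^-1) ^+ k))%:E)%E ->
  ((\sum_(0 <= k <oo) ((tau0 * omega ^+ k) `^ (p * alpha / 2))%:E * N k `^ p) `^ p^-1 <=
   (2 * F * (tau0 `^ (alpha / 2) / (1 - omega `^ 2^-1) * Delta alpha p s))%:E)%E.
Proof.
move=> p1 a0 t0 o0 o1 s0 s1 F0 N0 NF.
have p0 : 0 < p by rewrite (lt_le_trans ltr01).
pose q := omega `^ 2^-1.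
have q0 : 0 < q by rewrite powR_gt0.
have q1 : q < 1 by rewrite powR_lt1.
have q10 : 0 < 1 - q by rewrite subr_gt0.
have tauE k : (tau0 * omega ^+ k) `^ (p * alpha / 2) =
    (tau0 `^ (alpha / 2)) `^ p * (q ^+ k) `^ (p * alpha).
  rewrite powRM ?exprn_ge0 ?(ltW t0) ?(ltW o0)//; congr (_ * _).
    by rewrite -powRrM; congr powR; ring.
  have -> : omega ^+ k = omega `^ k%:R by rewrite powR_mulrn// ltW.
  have -> : q ^+ k = omega `^ (2^-1 * k%:R).
    by rewrite powRrM powR_mulrn// powR_ge0.
  by rewrite -!powRrM; congr powR; field.
have D0 : 0 <= Delta alpha p s by exact: Delta_ge0.
set M := (2 * F * (tau0 `^ (alpha / 2) / (1 - q) * Delta alpha p s)).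
have M0 : 0 <= M.
  by rewrite /M !mulr_ge0 ?powR_ge0 ?invr_ge0 ?(ltW q10).
have -> : (M%:E = (M `^ p)%:E `^ p^-1)%E.
  by rewrite poweR_EFin -powRrM divff ?gt_eqF// powRr1.
apply: gt0_ler_poweR.
- by rewrite invr_ge0 ltW.
- rewrite in_itv/= leey andbT nneseries_ge0// => k _ _.
  by rewrite mule_ge0 ?poweR_ge0 ?lee_fin ?powR_ge0.
- by rewrite in_itv/= leey andbT lee_fin powR_ge0.
apply: nneseries_le => [k|m].
  by rewrite mule_ge0 ?poweR_ge0 ?lee_fin ?powR_ge0.
pose c := (tau0 `^ (alpha / 2) * F) `^ p.
apply: (@le_trans _ _ (c * trunc_sum p alpha q s m)%:E).
  rewrite /trunc_sum mulr_sumr -sumEFin big_mkord.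
  apply: lee_sum => k _; rewrite tauE.
  have mk0 : 0 <= Num.min 1 (s / q ^+ k).
    by rewrite le_min ler01 divr_ge0// exprn_ge0// ltW.
  apply: (@le_trans _ _ (((tau0 `^ (alpha / 2)) `^ p * (q ^+ k) `^ (p * alpha))%:E *
      ((F * Num.min 1 (s / q ^+ k)) `^ p)%:E)%E).
    apply: lee_wpmul2l; first by rewrite lee_fin mulr_ge0 ?powR_ge0.
    rewrite -poweR_EFin; apply: gt0_ler_poweR; rewrite ?in_itv/= ?leey ?N0//; first exact: ltW.
    by rewrite andbT lee_fin mulr_ge0.
  rewrite -EFinM lee_fin /c !powRM ?powR_ge0//.
  by rewrite le_eqVlt; apply/orP; left; apply/eqP; ring.
rewrite lee_fin (le_trans (ler_wpM2l (powR_ge0 _ _) (trunc_sum_Delta m q0 q1 p1 a0 s0 s1)))//.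
have tF0 : 0 <= tau0 `^ (alpha / 2) * F by rewrite mulr_ge0 ?powR_ge0.
have D20 : 0 <= 2 * (Delta alpha p s / (1 - q)).
  by rewrite mulr_ge0// divr_ge0// ltW.
rewrite -(powRM _ tF0 D20) [leLHS](_ : _ = M `^ p)//.
by congr powR; rewrite /M; ring.
Qed.

End scale_series.

Unset Implicit Arguments.
Set Strict Implicit.
Set Printing Implicit Defensive.

Theorem corollary4p3 (R : realType) (d : nat) (hd : (1 <= d)%N) :
  exists2 C : R, 0 < C &
  forall (A B : set 'rV[R]_d) (phi : 'rV[R]_d -> 'rV[R]_d)
    (r p alpha tau0 omega : R) (f : 'rV[R]_d -> R),
    open A -> open B -> set_bij B A phi -> C1_on B phi ->
    1 <= r -> 1 <= p -> 0 < alpha -> 0 < tau0 -> 0 < omega -> omega < 1 ->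
    f \in Lfun (lebesgue_rV d) r%:E ->
    {ae lebesgue_rV d, forall x, ~ A x -> f x = 0} ->
    ('N[lebesgue_rV d]_(r%:E)[EFin \o deformation B phi f] <=
      'N[lebesgue_rV d]_(r%:E)[EFin \o f])%E ->
    (displacement B phi < (Num.sqrt tau0)%:E)%E ->
    (scale_metric alpha p r tau0 omega f (deformation B phi f) <=
      C%:E * 'N[lebesgue_rV d]_(r%:E)[EFin \o f] *
      (tau0 `^ (alpha / 2) / (1 - omega `^ 2^-1) *
       Delta alpha p (fine (displacement B phi) / Num.sqrt tau0))%:E)%E.
Proof.
(* The 2 comes from the summation, uniformly in alpha and p; the other factor from a single scale,
   uniformly in r. *)
exists (2 * smoothing_constant d).
  by rewrite mulr_gt0// (lt_le_trans _ (smoothing_constant_ge2 d)).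
move=> A B phi r p alpha tau0 omega f oA oB bij C1 r1 p1 a0 t0 o0 o1 fL fA gf disp.
have mf : measurable_fun [set: 'rV[R]_d] (f : _ -> measurableTypeR R).
  exact: set_mem (sub_Lfun_mfun fL).
have foo : ('N[lebesgue_rV d]_r%:E[EFin \o f] < +oo)%E.
  exact: set_mem (sub_Lfun_finLfun fL).
set Nf := ('N[lebesgue_rV d]_(r%:E)[EFin \o f])%E in foo gf *.
have Nf0 : (0 <= Nf)%E by exact: Lnorm_ge0.
have NfE : Nf = (fine Nf)%:E by rewrite fineK// ge0_fin_numE.
pose eps := fine (displacement B phi).
have st0 : 0 < Num.sqrt tau0 by rewrite sqrtr_gt0.
have disp_ub z : B z -> ((enorm (z - phi z))%:E <= displacement B phi)%E.
  by move=> Bz; apply: ereal_sup_ubound; exists z.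
have epsB z : B z -> enorm (z - phi z) <= eps.
  move=> /disp_ub zd; rewrite -lee_fin /eps fineK//.
  by rewrite fin_numElt (lt_le_trans _ zd) ?ltNyr// (lt_trans disp) ?ltry.
have eps0 : 0 <= eps.
  (* For empty B the displacement is -oo, and [fine] turns it into 0. *)
  have [[z Bz]|B0] := pselect (B !=set0); first by rewrite (le_trans _ (epsB z Bz))// sqrtr_ge0.
  rewrite /eps /displacement (_ : [set _ | _ in B] = set0) ?ereal_sup0//.
  by rewrite -subset0 => t [z Bz _]; apply: B0; exists z.
have epst : eps < Num.sqrt tau0.
  rewrite /eps; move: disp; by case: displacement => [t||].
have s0 : 0 <= eps / Num.sqrt tau0 by rewrite divr_ge0 ?sqrtr_ge0.
have s1 : eps / Num.sqrt tau0 < 1 by rewrite ltr_pdivrMr// mul1r.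
have tauk k : 0 < tau0 * omega ^+ k by rewrite mulr_gt0// exprn_gt0.
have F0 : 0 <= smoothing_constant d * fine Nf.
  by rewrite mulr_ge0 ?fine_ge0// (le_trans _ (smoothing_constant_ge2 d)).
rewrite NfE -!EFinM -[2 * _ * _]mulrA.
apply: series_scale_le => // k; first exact: Lnorm_ge0.
have := Lnorm_convolution_deformation_le oA oB bij C1 mf fA r1 foo gf (tauk k) eps0 epsB.
move=> /le_trans; apply; rewrite -/Nf NfE -EFinM lee_fin mulrAC.
(* What remains is eps / sqrt (tau_0 omega^k) = (eps / sqrt tau_0) / (omega^(1/2))^k. *)
rewrite le_eqVlt; apply/orP; left; apply/eqP; congr (_ * Num.min _ _).
rewrite sqrtrM ?(ltW t0)// -mulrA; congr (_ * _); rewrite invfM; congr (_ * _^-1).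
have -> : omega ^+ k = omega `^ k%:R by rewrite powR_mulrn// ltW.
by rewrite -powR12_sqrt ?powR_ge0// powRAC powR_mulrn// powR_ge0.
Qed.
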